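(* Let $\nu$ be a Borel probability measure on $\operatorname{Hom}(\mathbb{S}^1)$. Assume that $\Gamma_\nu$ is proximal and does not fix any point in $\mathbb{S}^1$. Then there exist measurable functions $\pi,\theta\colon X_\nu^{\mathbb{N}}\to\mathbb{S}^1$ such that: (1) for all $x\in\mathbb{S}^1$ and $\nu^{\mathbb{N}}$-almost every $\omega=(f_n)_{n\in\mathbb{N}}\in X_\nu^{\mathbb{N}}$, $$\lim_{n\to\infty} f_1\circ\cdots\circ f_n(x)=\pi(\omega)\quad\text{and}\quad \lim_{n\to\infty} f_1^{-1}\circ\cdots\circ f_n^{-1}(x)=\theta(\omega);$$ (2) for $\nu^{\mathbb{N}}$-almost every $\omega=(f_n)_{n\in\mathbb{N}}\in X_\nu^{\mathbb{N}}$ and every pair of closed sets $A\subset \mathbb{S}^1\setminus\{\theta(\omega)\}$, $B\subset\mathbb{S}^1\setminus\{\pi(\omega)\}$, $$\lim_{n\to\infty}\operatorname{diam} f_n\circ\cdots\circ f_1(A)=\lim_{n\to\infty}\operatorname{diam} f_n^{-1}\circ\cdots\circ f_1^{-1}(B)=0;$$ (3) for $\nu^{\mathbb{N}}$-almost every $\omega=(f_n)_{n\in\mathbb{N}}\in X_\nu^{\mathbb{N}}$, $$f_1(\pi(\sigma\omega))=\pi(\omega)\quad\text{and}\quad f_1(\theta(\omega))=\theta(\sigma\omega).$$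
   Context: $\mathbb{S}^1=\mathbb{R}/\mathbb{Z}$ with its usual metric $d$; $\operatorname{Hom}(\mathbb{S}^1)$ is the group of all homeomorphisms of $\mathbb{S}^1$ (orientation preserving or reversing), with the topology of uniform convergence. $X_\nu$ denotes the topological support of $\nu$ and $\Gamma_\nu$ the semigroup generated by $X_\nu$. $\Gamma_\nu$ is proximal if for all $x,y\in\mathbb{S}^1$ there is a sequence $(g_n)$ in $\Gamma_\nu$ with $d(g_n(x),g_n(y))\to0$. $\Gamma_\nu$ does not fix any point if there is no $x\in\mathbb{S}^1$ with $f(x)=x$ for all $f\in\Gamma_\nu$. $\nu^{\mathbb{N}}$ is the product measure on $X_\nu^{\mathbb{N}}$ and $\sigma\colon X_\nu^{\mathbb{N}}\to X_\nu^{\mathbb{N}}$, $\sigma((f_n)_{n\ge1})=(f_n)_{n\ge2}$, is the left shift. *)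

(* Defs.v *)
From HB Require Import structures.
From mathcomp Require Import all_boot all_order all_algebra.
From mathcomp Require Import all_classical all_reals all_analysis.
Set Implicit Arguments. Unset Strict Implicit. Unset Printing Implicit Defensive.
Import Order.TTheory GRing.Theory Num.Theory.
Import numFieldNormedType.Exports.
Local Open Scope classical_set_scope.
Local Open Scope ring_scope.

Section Circle.
Context {R : realType}.

(* S^1 = R/Z, represented by the fundamental domain [0,1). *)
Definition circ := {x : R | (0 <= x) && (x < 1)}.
Lemma circ0_subproof : (0 <= (0:R)) && (0 < (1:R)).
Proof. by rewrite lexx ltr01. Qed.
Definition circ0 : circ := exist _ 0 circ0_subproof.
HB.instance Definition _ := gen_eqMixin circ.
HB.instance Definition _ := gen_choiceMixin circ.
HB.instance Definition _ := isPointed.Build circ circ0.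

(* The usual (quotient) metric on R/Z. *)
Definition cdist (x y : circ) : R :=
  let t := `|sval x - sval y| in Num.min t (1 - t).

Definition circ_open (U : set circ) : Prop :=
  forall x, U x -> exists2 e : R, 0 < e & forall y, cdist x y < e -> U y.
Definition circ_closed (A : set circ) : Prop :=
  forall x, (forall e : R, 0 < e -> exists2 a, A a & cdist a x < e) -> A x.
Definition circB := g_sigma_algebraType circ_open.

Definition ccvg (u : nat -> circ) (l : circ) : Prop :=
  (fun n => cdist (u n) l) @ \oo --> (0 : R).

Definition cdiam (A : set circ) : R :=
  sup [set cdist x y | x in A & y in A].

Definition ccontinuous (f : circ -> circ) : Prop :=
  forall x (e : R), 0 < e ->
    exists2 d : R, 0 < d & forall y, cdist x y < d -> cdist (f x) (f y) < e.

Record homeo := Homeo {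
  hfun : circ -> circ;
  hinv : circ -> circ;
  hfunK : cancel hfun hinv;
  hinvK : cancel hinv hfun;
  hfun_cont : ccontinuous hfun;
  hinv_cont : ccontinuous hinv }.

Lemma id_ccont : ccontinuous id.
Proof. by move=> x e e0; exists e. Qed.
Definition homeo_id : homeo :=
  @Homeo id id (fun _ => erefl) (fun _ => erefl) id_ccont id_ccont.

HB.instance Definition _ := gen_eqMixin homeo.
HB.instance Definition _ := gen_choiceMixin homeo.
HB.instance Definition _ := isPointed.Build homeo homeo_id.

Definition hdist (f g : homeo) : R := sup (range (fun x => cdist (hfun f x) (hfun g x))).
Definition hball (f : homeo) (e : R) : set homeo := [set g | hdist f g < e].
Definition hom_open (U : set homeo) : Prop :=
  forall f, U f -> exists2 e : R, 0 < e & hball f e `<=` U.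
Definition homB := g_sigma_algebraType hom_open.

Definition hsupport (nu : set homB -> \bar R) : set homeo :=
  [set f | forall e : R, 0 < e -> (0 < nu (hball f e))%E].

Inductive gen_semigroup (X : set homeo) : (circ -> circ) -> Prop :=
| sg_gen f : X f -> gen_semigroup X (hfun f)
| sg_comp g h : gen_semigroup X g -> gen_semigroup X h -> gen_semigroup X (g \o h).

Definition proximal (G : (circ -> circ) -> Prop) : Prop :=
  forall x y : circ, exists g : nat -> (circ -> circ),
    (forall n, G (g n)) /\ (fun n => cdist (g n x) (g n y)) @ \oo --> (0 : R).

Definition fixes_no_point (G : (circ -> circ) -> Prop) : Prop :=
  ~ exists x : circ, forall f, G f -> f x = x.

(* sequence space Hom(S^1)^N with the product sigma-algebra generated by
   the cylinders {w | w i \in A}, A Borel; index i corresponds to f_(i+1). *)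
Definition cylinders : set (set (nat -> homB)) :=
  [set C | exists i (A : set homB), measurable A /\ C = [set w | A (w i)]].
Definition seqB := g_sigma_algebraType cylinders.

(* P is the product measure nu^N: its values on finite-dimensional
   rectangles are the products of the nu-measures (this determines P). *)
Definition is_product_measure (nu : set homB -> \bar R) (P : set seqB -> \bar R) :=
  forall (n : nat) (A : nat -> set homB), (forall i, measurable (A i)) ->
    P [set w : seqB | forall i, (i < n)%N -> A i (w i)] = (\prod_(i < n) nu (A i))%E.

Definition in_seq_support (nu : set homB -> \bar R) : set seqB :=
  [set w | forall i, hsupport nu (w i)].

Definition sshift (w : seqB) : seqB := fun n => w n.+1.

Fixpoint lcomp (w : nat -> homeo) (n : nat) : circ -> circ :=
  if n is m.+1 then lcomp w m \o hfun (w m) else id.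
Fixpoint linv (w : nat -> homeo) (n : nat) : circ -> circ :=
  if n is m.+1 then linv w m \o hinv (w m) else id.
Fixpoint rcomp (w : nat -> homeo) (n : nat) : circ -> circ :=
  if n is m.+1 then hfun (w m) \o rcomp w m else id.
Fixpoint rinv (w : nat -> homeo) (n : nat) : circ -> circ :=
  if n is m.+1 then hinv (w m) \o rinv w m else id.

End Circle.

(* Main.v *)
Require Import Defs.
From HB Require Import structures.
From mathcomp Require Import all_boot all_order all_algebra.
From mathcomp Require Import all_classical all_reals all_analysis.
From mathcomp Require Import measurable_realfun ring lra zify.
Import Order.TTheory GRing.Theory Num.Theory.
Import numFieldNormedType.Exports.
Set Implicit Arguments. Unset Strict Implicit. Unset Printing Implicit Defensive.
Local Open Scope classical_set_scope.
Local Open Scope ring_scope.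

(* Write T_n for f_1 o ... o f_n or f_1^-1 o ... o f_n^-1, and for s in [0,1] let p_n(x, y) be the
   probability that exactly one of T_n x, T_n y lies in the arc [0, s). The crux is that
   p_n(x, y) <= C rho^n with rho < 1, uniformly in x, y and s. Freezing the m innermost maps shows
   that p_(n+m) is an average of the functions p_n(h x, h y), h ranging over m-fold products, and
   such an average does not increase the 2-variation sup (sum_i F(e_i)^2) over disjoint arcs e_i.
   By proximality and the absence of fixed points there are 36 words of the same length m mapping
   the complement of an arc I_j into an arc J_j, with the I_j disjoint and the J_j disjoint; by the
   argument of Powers for free groups, averaging F o h_j over k such maps multiplies the
   2-variation by O(1 / sqrt k), so the m-step average contracts it strictly.
   Since T_(n+1) x = T_n (f_(n+1)^(+-1) x), Borel-Cantelli makes the position of T_n x with respect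
   to each rational arc eventually constant, which gives convergence to a limit independent of x.
   For (2), if f_1^-1 o ... o f_n^-1 maps the points i/N close to theta, then f_n o ... o f_1 maps
   the complement of a neighbourhood of theta to a connected set missing all i/N, hence of diameter
   at most 1/N. Finally (3) is shift equivariance of the limits. *)

(** * The geometry of the circle *)

Section CircleGeometry.
Context {R : realType}.
Implicit Types (x y z p : @circ R) (s t e : R).

Lemma circ_ge0 x : 0 <= sval x. Proof. by case: x => x /= /andP[]. Qed.
Lemma circ_lt1 x : sval x < 1. Proof. by case: x => x /= /andP[]. Qed.

(** Together with [cdist_int] this makes [cdist] the minimum of |x - y + k| over the integers k;
    inequalities on the circle then follow by adding integers. *)
Lemma cdist_le_int x y (k : int) : cdist x y <= `|sval x - sval y + k%:~R|.
Proof.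
have := circ_ge0 x; have := circ_lt1 x; have := circ_ge0 y; have := circ_lt1 y.
rewrite /cdist /= ge_min; move: (sval x) (sval y) => a b b1 b0 a1 a0.
have [k0|k0|->] := ltgtP k 0; last by rewrite addr0 lexx.
- have {}k0 : k%:~R <= -1 :> R.
    by rewrite -(rmorphN1 (intr : int -> R)) ler_int; lia.
  rewrite [`|_ + k%:~R|]ler0_norm; last lra.
  case: (leP b a) => ba; [rewrite ger0_norm ?subr_ge0//|rewrite ltr0_norm ?subr_lt0//];
  apply/orP; [right|left]; lra.
- have {}k0 : 1 <= k%:~R :> R by rewrite -[1]/(1%:~R) ler_int; lia.
  rewrite [`|_ + k%:~R|]ger0_norm; last lra.
  case: (leP b a) => ba; [rewrite ger0_norm ?subr_ge0//|rewrite ltr0_norm ?subr_lt0//];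
  apply/orP; [left|right]; lra.
Qed.

Lemma cdist_int x y : exists k : int, cdist x y = `|sval x - sval y + k%:~R|.
Proof.
have := circ_ge0 x; have := circ_lt1 x; have := circ_ge0 y; have := circ_lt1 y.
rewrite /cdist /=; move: (sval x) (sval y) => a b b1 b0 a1 a0.
rewrite /Num.min; case: ifP => _; first by exists 0; rewrite addr0.
case: (leP b a) => ba.
- exists (-1); rewrite [in RHS]ltr0_norm ?ger0_norm; rewrite ?mulrN1z; lra.
- exists 1; rewrite [in RHS]gtr0_norm ?ltr0_norm; lra.
Qed.

Lemma cdist_ge0 x y : 0 <= cdist x y.
Proof. by have [k ->] := cdist_int x y. Qed.

Lemma cdistxx x : cdist x x = 0.
Proof. by rewrite /cdist subrr normr0 subr0 min_l. Qed.

Lemma cdistC x y : cdist x y = cdist y x.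
Proof. by rewrite /cdist distrC. Qed.

Lemma cdist_triangle y x z : cdist x z <= cdist x y + cdist y z.
Proof.
have [k ->] := cdist_int x y; have [l ->] := cdist_int y z.
apply: le_trans (ler_normD _ _); apply: le_trans (cdist_le_int _ _ (k + l)) _.
by rewrite intrD le_eqVlt; apply/orP; left; apply/eqP; congr `|_|; ring.
Qed.

Lemma cdist_le_half x y : cdist x y <= 1/2.
Proof. by rewrite /cdist ge_min; case: (leP `|sval x - sval y| (1/2)) => h //=; lra. Qed.

Lemma cdist_le_dist x y : cdist x y <= `|sval x - sval y|.
Proof. by rewrite /cdist ge_min lexx. Qed.

Lemma cdist_eq0 x y : cdist x y = 0 -> x = y.
Proof.
have := circ_ge0 x; have := circ_lt1 x; have := circ_ge0 y; have := circ_lt1 y.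
move=> b1 b0 a1 a0; rewrite /cdist /= => h.
have {}h : sval x = sval y.
  apply/eqP; rewrite -subr_eq0 -normr_eq0; apply/eqP.
  move: h; rewrite /Num.min; case: ifP => // _ h.
  by case: (leP (sval y) (sval x)) h => ba; [rewrite ger0_norm|rewrite ltr0_norm]; lra.
by case: x y h {b1 b0 a1 a0} => x Hx [y Hy] /= h; subst y; congr exist; exact: bool_irrelevance.
Qed.

Lemma cdist_gt0 x y : x <> y -> 0 < cdist x y.
Proof. by move=> h; rewrite lt_neqAle cdist_ge0 andbT eq_sym; apply/eqP => /cdist_eq0. Qed.

Lemma sval_close x y e : cdist x y < e -> e <= sval x -> e <= 1 - sval x ->
  `|sval x - sval y| < e.
Proof.
have := circ_ge0 y; have := circ_lt1 y => b1 b0.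
rewrite /cdist gt_min => /orP[//|h h1 h2].
by case: (leP (sval y) (sval x)) h => ba; [rewrite ger0_norm|rewrite ltr0_norm]; lra.
Qed.

Lemma cproj_subproof t : (0 <= t - (Num.floor t)%:~R) && (t - (Num.floor t)%:~R < 1).
Proof.
have /andP[] := floor_itv t; rewrite intrD => h1 h2.
by apply/andP; split; [rewrite subr_ge0|rewrite ltrBlDl].
Qed.
Definition cproj t : @circ R := exist _ (t - (Num.floor t)%:~R) (cproj_subproof t).

Lemma cdist_cproj s t : cdist (cproj s) (cproj t) <= `|s - t|.
Proof.
apply: le_trans (cdist_le_int _ _ (Num.floor s - Num.floor t)) _.
rewrite /= intrB le_eqVlt; apply/orP; left; apply/eqP; congr `|_|; ring.
Qed.

Lemma cproj_sval x : cproj (sval x) = x.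
Proof.
apply: cdist_eq0; apply/eqP; rewrite eq_le cdist_ge0 andbT.
apply: le_trans (cdist_le_int _ _ (Num.floor (sval x))) _.
by rewrite /= normr_le0; apply/eqP; ring.
Qed.

Lemma cprojDint t (k : int) : cproj (t + k%:~R) = cproj t.
Proof.
apply: cdist_eq0; apply/eqP; rewrite eq_le cdist_ge0 andbT.
apply: le_trans (cdist_le_int _ _ (Num.floor (t + k%:~R) - k - Num.floor t)) _.
by rewrite /= !intrB normr_le0; apply/eqP; ring.
Qed.

(* The two points are p + e and p - e. *)
Lemma sphere_two_points p e : exists a b, forall x, cdist x p = e -> x = a \/ x = b.
Proof.
exists (cproj (sval p + e)), (cproj (sval p - e)) => x.
have [k ->] := cdist_int x p.
case: (leP 0 (sval x - sval p + k%:~R)) => h; [rewrite ger0_norm//|rewrite ltr0_norm//] => he.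
- left; rewrite -he -{1}(cproj_sval x) -[LHS](cprojDint _ k); congr cproj; ring.
- right; rewrite -he -{1}(cproj_sval x) -[LHS](cprojDint _ k); congr cproj; ring.
Qed.

Definition cball p e : set (@circ R) := [set x | cdist x p < e].

Lemma cball_open p e : circ_open (cball p e).
Proof.
move=> x xp; exists (e - cdist x p); first by rewrite subr_gt0.
move=> y; rewrite /cball /= => xy; apply: le_lt_trans (cdist_triangle x _ _) _.
by rewrite cdistC -ltrBrDr.
Qed.

Lemma cball_ext_open p e : circ_open [set x | e < cdist x p].
Proof.
move=> x /= xp; exists (cdist x p - e); first by rewrite subr_gt0.
by move=> y xy; have := cdist_triangle y x p; lra.
Qed.

(** Connectedness with respect to [circ_open]. It takes the place of cyclic order: arcs are
    connected, and homeomorphisms preserve connectedness ([cconn_image]). *)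
Definition cconn (E : set (@circ R)) := forall U V, circ_open U -> circ_open V ->
  E `<=` U `|` V -> (forall x, E x -> U x -> V x -> False) -> E `<=` U \/ E `<=` V.

Lemma cproj_preimage_open (U : set (@circ R)) : circ_open U -> open (cproj @^-1` U).
Proof.
move=> oU; rewrite openE => t /= Ut; have [e e0 eU] := oU _ Ut.
apply/nbhs_ballP; exists e => //= u; rewrite /ball /= => tu.
by apply: eU; apply: le_lt_trans (cdist_cproj _ _) tu.
Qed.

(** A separation of the image pulls back along the continuous [cproj] to a separation of an interval
    of R. The circle, balls and complements of balls are treated as such images. *)
Lemma cconn_cproj (I : interval R) : cconn (cproj @` [set` I]).
Proof.
move=> U V oU oV EUV dUV; case: (pselect (exists2 t, [set` I] t & U (cproj t))); last first.
  move=> nU; right=> _ [t It <-].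
  by case: (EUV (cproj t)) => // Ut; exfalso; apply: nU; exists t.
move=> [t It Ut]; left => _ [u Iu <-].
have cI : connected [set` I] by apply/connected_intervalP/interval_is_interval.
have : [set` I] `&` (cproj @^-1` U) = [set` I].
  apply: cI.
  - by exists t.
  - by exists (cproj @^-1` U) => //; apply: cproj_preimage_open.
  - exists (~` (cproj @^-1` V)); first by apply/open_closedC/cproj_preimage_open.
    apply/seteqP; split => v [Iv Uv]; split => //.
      by move=> Vv; apply: (dUV (cproj v)) => //; exists v.
    by case: (EUV (cproj v)) => //; exists v.
by move=> h; have [] : ([set` I] `&` cproj @^-1` U) u by rewrite h.
Qed.

Lemma cconnT : cconn setT.
Proof.
suff -> : setT = cproj @` [set` `[(0:R), 1]] by exact: cconn_cproj.
apply/seteqP; split => // x _; exists (sval x); last exact: cproj_sval.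
by rewrite /= in_itv /= circ_ge0 ltW ?circ_lt1.
Qed.

Lemma cconn_cball p e : cconn (cball p e).
Proof.
suff -> : cball p e = cproj @` [set` `](sval p - e), (sval p + e)[ ] by exact: cconn_cproj.
apply/seteqP; split => [x|x [t /=]]; rewrite /cball /=.
  have [k ->] := cdist_int x p; rewrite ltr_norml => /andP[h1 h2].
  exists (sval x + k%:~R); last by rewrite cprojDint cproj_sval.
  by rewrite /= in_itv /=; apply/andP; split; lra.
rewrite in_itv /= => /andP[h1 h2] <-; rewrite -{1}(cproj_sval p).
by apply: le_lt_trans (cdist_cproj _ _) _; rewrite ltr_norml; apply/andP; split; lra.
Qed.

Lemma cconn_cballC p e : cconn (~` cball p e).
Proof.
suff -> : ~` cball p e = cproj @` [set` `[(sval p + e), (sval p + 1 - e)] ] by exact: cconn_cproj.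
have := circ_ge0 p; have := circ_lt1 p => p1 p0.
apply/seteqP; split => [x|x [t /=]]; rewrite /cball /=.
  have := circ_ge0 x; have := circ_lt1 x => x1 x0 /negP; rewrite -leNgt => h.
  case: (leP (sval p) (sval x)) => px.
  - exists (sval x); last exact: cproj_sval.
    have := cdist_le_int x p (-1); have := cdist_le_int x p 0.
    rewrite mulrN1z addr0 ger0_norm; last lra.
    by rewrite ler0_norm; last lra; rewrite /= in_itv /= => h1 h2; apply/andP; split; lra.
  - exists (sval x + 1); last by rewrite -[1]/(1%:~R) cprojDint cproj_sval.
    have := cdist_le_int x p 1; have := cdist_le_int x p 0.
    rewrite addr0 ler0_norm; last lra.
    by rewrite ger0_norm; last lra; rewrite /= in_itv /= => h1 h2; apply/andP; split; lra.
rewrite in_itv /= => /andP[h1 h2] <-; apply/negP; rewrite -leNgt.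
have [k ->] := cdist_int (cproj t) p; rewrite /=.
set l : R := t - _ - _ + _.
have -> : l = t - sval p + (k - Num.floor t)%:~R by rewrite /l intrB; ring.
move: (k - _) => {k l} k; have [k0|k0] := lerP 0 k.
- have {}k0 : 0 <= k%:~R :> R by rewrite ler0z.
  by apply: le_trans (ler_norm _); lra.
- have {}k0 : k%:~R <= -1 :> R by rewrite -(rmorphN1 (intr : int -> R)) ler_int; lia.
  by rewrite -normrN; apply: le_trans (ler_norm _); lra.
Qed.

Lemma cconn_sep E (U V : set (@circ R)) x : cconn E -> circ_open U -> circ_open V ->
  E `<=` U `|` V -> (forall x, U x -> V x -> False) -> E x -> U x -> E `<=` U.
Proof.
move=> cE oU oV EUV dUV Ex Ux; case: (cE U V) => // [z _ |EV]; first exact: dUV.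
by case: (dUV x Ux (EV x Ex)).
Qed.

(* The set {sval < s} is the arc [0, s): its frontier consists of 0 and s. *)
Lemma cconn_lt_const E s x y : 0 <= s -> cconn E -> ~ E (cproj 0) -> ~ E (cproj s) ->
  E x -> E y -> (sval x < s) = (sval y < s).
Proof.
move=> s0 cE E0 Es Ex Ey.
have [s1|s1] := ltrP s 1; last first.
  by rewrite (lt_le_trans (circ_lt1 x) s1) (lt_le_trans (circ_lt1 y) s1).
have z0 z : E z -> 0 < sval z.
  move=> Ez; rewrite lt_neqAle circ_ge0 andbT; apply/eqP => h; apply: E0.
  by rewrite h cproj_sval.
have zs z : E z -> sval z != s by move=> Ez; apply/eqP => h; apply: Es; rewrite -h cproj_sval.
(* The point 0, which E misses, is left out of U because [0, s) is not open on the circle when 0 < s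
   < 1. *)
pose U : set (@circ R) := [set z | 0 < sval z < s]; pose V : set (@circ R) := [set z | s < sval z].
have oU : circ_open U.
  move=> z /= /andP[h1 h2]; exists (Num.min (sval z) (s - sval z)).
    by rewrite lt_min h1 subr_gt0.
  move=> u zu; have := sval_close zu; rewrite !ge_min lexx /= => /(_ isT).
  have -> : s - sval z <= 1 - sval z by lra.
  rewrite orbT => /(_ isT); rewrite lt_min !ltr_norml => /andP[/andP[a b] /andP[c d]].
  by rewrite /U /=; apply/andP; split; lra.
have oV : circ_open V.
  move=> z /= h1; have z1 := circ_lt1 z; exists (Num.min (sval z - s) (1 - sval z)).
    by rewrite lt_min !subr_gt0 h1.
  move=> u zu; have := sval_close zu; rewrite !ge_min lexx orbT.
  have -> : sval z - s <= sval z by lra.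
  move=> /(_ isT isT); rewrite lt_min !ltr_norml => /andP[/andP[a b] /andP[c d]].
  by rewrite /V /=; lra.
have EUV : E `<=` U `|` V.
  move=> z Ez; have := zs z Ez; rewrite neq_lt => /orP[h|h]; [left|by right].
  by rewrite /U /= z0.
have dUV z : U z -> V z -> False by rewrite /U /V /= => /andP[_ h] h'; lra.
have tr z z' : E z -> E z' -> sval z < s -> sval z' < s.
  move=> Ez Ez' h; have Uz : U z by rewrite /U /= z0.
  by have /(_ _ Ez')/andP[] := cconn_sep cE oU oV EUV dUV Ez Uz.
by apply/idP/idP; apply: tr.
Qed.

Definition grid (N i : nat) : @circ R := cproj (i%:R / N%:R).

Lemma cell_dist (N : nat) x y : (0 < N)%N ->
  (forall i : nat, (sval x < i%:R / N%:R) = (sval y < i%:R / N%:R)) ->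
  `|sval x - sval y| <= N%:R^-1.
Proof.
move=> N0 h.
have N0' : 0 < N%:R :> R by rewrite ltr0n.
have /natrP [i hi] : (Num.floor (N%:R * sval x))%:~R \is a @Num.nat_num R.
  by rewrite -[Num.floor _]gez0_abs ?floor_ge0 ?mulr_ge0 ?circ_ge0 ?ler0n// natr_nat.
have /andP[] := floor_itv (N%:R * sval x); rewrite intrD hi => a b.
have a' : i%:R / N%:R <= sval x by rewrite ler_pdivrMr // mulrC.
have b' : sval x < i.+1%:R / N%:R by rewrite ltr_pdivlMr // mulrC -natr1.
have := h i; rewrite ltNge a' /= => /esym/negbT; rewrite -leNgt => c.
have := h i.+1; rewrite b' => /esym d.
have e : i.+1%:R / N%:R - i%:R / N%:R = N%:R^-1 :> R.
  by rewrite -mulrBl -natr1 addrAC subrr add0r mul1r.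
by rewrite ler_norml; apply/andP; split; lra.
Qed.

(** By [cconn_lt_const] no threshold i/N separates two points of E, so they share a cell of length
    1/N; the grid contains 0, hence E cannot cross the cut. *)
Lemma cconn_grid (N : nat) E x y : (0 < N)%N -> cconn E ->
  (forall i, (i < N)%N -> ~ E (grid N i)) -> E x -> E y -> cdist x y <= N%:R^-1.
Proof.
move=> N0 cE hE Ex Ey; apply: le_trans (cdist_le_dist x y) _; apply: cell_dist => // i.
have N0' : 0 < N%:R :> R by rewrite ltr0n.
have E0 : ~ E (cproj 0) by have := hE 0%N N0; rewrite /grid mul0r.
have [iN|Ni] := ltnP i N.
  by apply: cconn_lt_const cE E0 (hE i iN) Ex Ey; rewrite divr_ge0.
have h : 1 <= i%:R / N%:R :> R by rewrite ler_pdivlMr// mul1r ler_nat.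
by rewrite (lt_le_trans (circ_lt1 x) h) (lt_le_trans (circ_lt1 y) h).
Qed.

(** The at most two points at distance e from p separate the ball from the open exterior, so a
    connected set that avoids them cannot leave the ball. *)
Lemma cball_frontier p e : exists a b, forall E x y, cconn E -> ~ E a -> ~ E b ->
  E x -> E y -> cball p e x -> cball p e y.
Proof.
have [a [b hab]] := sphere_two_points p e; exists a, b => E x y cE Ea Eb Ex Ey px.
suff h : E `<=` cball p e by exact: h.
have EUV : E `<=` cball p e `|` [set z | e < cdist z p].
  move=> z Ez; rewrite /cball /=; case: (ltgtP (cdist z p) e) => h; [by left|by right|].
  by case: (hab z h) => hz; subst z.
apply: (cconn_sep cE (@cball_open p e) (@cball_ext_open p e) EUV _ Ex px).
by move=> z; rewrite /cball /= => h1 h2; lra.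
Qed.

End CircleGeometry.

(** * Measurability *)

Section Measurability.
Context {R : realType}.

Lemma divr2_gt0 (e : R) : 0 < e -> 0 < e / 2.
Proof. by move=> e0; rewrite divr_gt0. Qed.

Lemma circ_open_measurable (U : set (@circB R)) : circ_open U -> measurable U.
Proof. exact: sub_sigma_algebra. Qed.

Lemma measurable_circP d (T : measurableType d) (u : T -> @circB R) :
  (forall U : set (@circ R), circ_open U -> measurable (u @^-1` U)) -> measurable_fun setT u.
Proof.
move=> h; apply: (@measurability _ _ _ (@circB R) setT u (@circ_open R)) => // _ [U oU <-].
by rewrite setTI; apply: h.
Qed.

Lemma measurable_preim d d' (T : measurableType d) (T' : measurableType d') (u : T -> T')
  (A : set T') : measurable_fun setT u -> measurable A -> measurable (u @^-1` A).
Proof. by move=> mu mA; rewrite -[_ @^-1` _]setTI; exact: mu. Qed.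

Lemma measurable_sval : measurable_fun [set: @circB R] (fun x : @circB R => sval x : R).
Proof.
apply: (@measurability _ _ _ _ setT (fun x : @circB R => sval x : R)
  (@RGenInftyO.G R)); first exact: RGenInftyO.measurableE.
move=> _ [_ [s ->] <-]; rewrite setTI.
(* [sval] jumps at 0, so the preimage is an open arc together with the closed set {0}, the latter
   only for s > 0. *)
have -> : (fun x : @circB R => sval x : R) @^-1` `]-oo, s[%classic =
  [set x | 0 < sval x < s] `|` [set x | sval x = 0 /\ 0 < s].
  apply/seteqP; split => x /=; rewrite in_itv /=.
    move=> h; have := circ_ge0 x; rewrite le_eqVlt => /orP[/eqP h0|h0].
      by right; split; [exact: esym|rewrite -h0 in h].
    by left; rewrite h0 h.
  by case=> [/andP[]//|[-> ]].
apply: measurableU.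
  apply: circ_open_measurable => x /= /andP[h1 h2].
  have x1 := circ_lt1 x.
  exists (Num.min (sval x) (Num.min (s - sval x) (1 - sval x))).
    by rewrite !lt_min h1 !subr_gt0 h2.
  move=> y xy; have := sval_close xy; rewrite !ge_min !lexx !orbT => /(_ isT isT).
  rewrite !lt_min !ltr_norml => /and3P[/andP[a b] /andP[c e] _].
  by apply/andP; split; lra.
have [s0|s0] := ltrP 0 s; last first.
  rewrite (_ : [set x | _] = set0) //.
  by apply/seteqP; split => x /= => [[_ h]|[]]; lra.
rewrite -[X in measurable X]setCK; apply: measurableC; apply: circ_open_measurable => x /= hx.
have {}hx : 0 < sval x.
  rewrite lt_neqAle circ_ge0 andbT; apply/eqP => h; apply: hx.
  by split.
have x1 := circ_lt1 x.
exists (Num.min (sval x) (1 - sval x)); first by rewrite lt_min hx subr_gt0.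
move=> y xy [y0 _]; have := sval_close xy; rewrite !ge_min !lexx !orbT => /(_ isT isT).
by rewrite !lt_min !ltr_norml y0 => /andP[/andP[a b] _]; lra.
Qed.

Lemma measurable_cproj : measurable_fun [set: R] (cproj : R -> @circB R).
Proof.
apply: measurable_circP => U oU; apply: open_measurable; exact: cproj_preimage_open.
Qed.

Lemma circ_cvgP (u : nat -> @circ R) l :
  ccvg u l <-> forall e, 0 < e -> exists N, forall n, (N <= n)%N -> cdist (u n) l < e.
Proof.
split=> [/cvgrPdist_lt h e e0|h].
  have [N _ hN] := h e e0; exists N => n Nn; have := hN n Nn.
  by rewrite /= sub0r normrN ger0_norm ?cdist_ge0.
apply/cvgrPdist_lt => e e0; have [N hN] := h e e0; exists N => // n Nn /=.
by rewrite sub0r normrN ger0_norm ?cdist_ge0//; apply: hN.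
Qed.

(** The limit lies in an open U exactly when, for some j, the sequence is eventually in the set
    [V j] of points whose ball of radius 1/(j+1) lies in U; [V j] is closed. *)
Lemma measurable_ccvg d (T : measurableType d) (u : nat -> T -> @circB R) (v : T -> @circB R) :
  (forall n, measurable_fun setT (u n)) -> (forall t, ccvg (u^~ t) (v t)) ->
  measurable_fun setT v.
Proof.
move=> mu uv; apply: measurable_circP => U oU.
pose V (j : nat) : set (@circ R) := [set x | forall y, cdist x y < j.+1%:R^-1 -> U y].
have mV j : measurable (V j : set (@circB R)).
  rewrite -[V j]setCK; apply: measurableC; apply: circ_open_measurable => x /= /existsNP[y /not_implyP[xy Uy]].
  exists (j.+1%:R^-1 - cdist x y); first by rewrite subr_gt0.
  move=> z xz /(_ y) h; apply/Uy/h; apply: le_lt_trans (cdist_triangle x _ _) _.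
  by rewrite cdistC -ltrBrDr.
rewrite (_ : v @^-1` U = \bigcup_j \bigcup_K \bigcap_(k in [set k | (K <= k)%N]) (u k @^-1` V j)).
  apply: bigcupT_measurable => j; apply: bigcupT_measurable => K.
  by apply: bigcap_measurableType => k _; exact: measurable_preim.
apply/seteqP; split => t /=.
- move=> Ut; have [e e0 eU] := oU _ Ut.
  have [j je] : exists j : nat, j.+1%:R^-1 < e / 2.
    have e2 : 0 < e / 2 by rewrite divr_gt0.
    have := near_infty_natSinv_lt (PosNum e2) => -[j _ /(_ j (leqnn j)) /= h].
    by exists j.
  have [K hK] := (circ_cvgP _ _).1 (uv t) _ (divr2_gt0 e0).
  exists j => //; exists K => // k /= Kk y uy; apply: eU.
  apply: le_lt_trans (cdist_triangle (u k t) _ _) _.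
  by rewrite [e]splitr; apply: ltrD; [rewrite cdistC; exact: hK|exact: lt_trans uy je].
- move=> [j _ [K _ h]].
  have [K' hK] := (circ_cvgP _ _).1 (uv t) j.+1%:R^-1 ltac:(by rewrite invr_gt0).
  by apply: (h (maxn K K')); [rewrite /= leq_maxl|rewrite hK// leq_maxr].
Qed.

Lemma natfloor_itv (a : R) : 0 <= a -> `|Num.floor a|%N%:R <= a < `|Num.floor a|%N%:R + 1.
Proof.
move=> a0; have := floor_itv a; rewrite intrD -{1 2}(@gez0_abs (Num.floor a)) ?floor_ge0//.
Qed.

Definition rounding (k : nat) (x : @circ R) : @circ R :=
  grid k.+1 `|Num.floor (k.+1%:R * sval x)|.

Lemma rounding_dist k x : cdist (rounding k x) x <= k.+1%:R^-1.
Proof.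
have k0 : 0 < k.+1%:R :> R by rewrite ltr0n.
rewrite /rounding /grid -{2}(cproj_sval x); apply: le_trans (cdist_cproj _ _) _.
have /andP[] := natfloor_itv (mulr_ge0 (ltW k0) (circ_ge0 x)).
move: `|_|%N => i a b; have -> : i%:R / k.+1%:R - sval x = (i%:R - k.+1%:R * sval x) / k.+1%:R.
  by rewrite mulrBl mulrAC divff ?mul1r// gt_eqF.
rewrite normrM [X in _ * X]gtr0_norm ?invr_gt0// ler_piMl ?invr_ge0// ?(ltW k0)//.
by rewrite ler_norml; apply/andP; split; lra.
Qed.

(** Needed to evaluate the random map of n steps at the random point produced by the next map.
    Rounding u to grids leaves countably many values, on each of which a single map [Phi^~ y]
    occurs; continuity of [Phi t] passes to the limit. *)
Lemma measurable_caratheodory d (T : measurableType d) (Phi : T -> @circ R -> @circB R)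
    (u : T -> @circB R) : (forall t, ccontinuous (Phi t)) ->
  (forall y, measurable_fun setT (Phi^~ y)) -> measurable_fun setT u ->
  measurable_fun setT (fun t => Phi t (u t)).
Proof.
move=> cPhi mPhi mu.
apply: (@measurable_ccvg _ _ (fun k t => Phi t (rounding k (u t)))); last first.
  move=> t; apply/circ_cvgP => e e0; have [d0 d00 hd] := cPhi t (u t) e e0.
  have := near_infty_natSinv_lt (PosNum d00) => -[j _ h].
  exists j => n jn; rewrite cdistC; apply: hd; rewrite cdistC.
  by apply: le_lt_trans (rounding_dist _ _) _; exact: h.
move=> k; apply: measurable_circP => U oU.
rewrite (_ : _ @^-1` U = \bigcup_i
  ((u @^-1` [set x | `|Num.floor (k.+1%:R * sval x)|%N = i]) `&` (Phi^~ (grid k.+1 i)) @^-1` U)).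
  apply: bigcupT_measurable => i; apply: measurableI; last first.
    by apply: measurable_preim => //; exact: circ_open_measurable.
  apply: measurable_preim => //.
  rewrite (_ : [set x | _] = (fun x : @circB R => sval x) @^-1`
     [set` `[(i%:R / k.+1%:R), (i.+1%:R / k.+1%:R)[ ]).
    by apply: measurable_preim; [exact: measurable_sval|exact: measurable_itv].
  have k0 : 0 < k.+1%:R :> R by rewrite ltr0n.
  apply/seteqP; split => x /=; rewrite in_itv /= ler_pdivrMr // ltr_pdivlMr // (mulrC (sval x)).
    by move=> <-; rewrite -[X in _ < X]natr1; apply: natfloor_itv; rewrite mulr_ge0 ?circ_ge0// ltW.
  move=> h; rewrite (@floor_def _ _ i)//.
  by rewrite intrD -!pmulrn natr1.
apply/seteqP; split => t /=; last by move=> [i _ /= [<-]].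
by move=> h; exists `|Num.floor (k.+1%:R * sval (u t))|%N.
Qed.

Lemma hdist_ub (f g : @homeo R) x : cdist (hfun f x) (hfun g x) <= hdist f g.
Proof.
apply: sup_upper_bound; last by exists x.
split; first by exists (cdist (hfun f x) (hfun g x)), x.
by exists (1/2) => _ [y _ <-]; exact: cdist_le_half.
Qed.

Lemma hdist_le (f g : @homeo R) e :
  (forall x, cdist (hfun f x) (hfun g x) <= e) -> hdist f g <= e.
Proof.
move=> h; apply: ge_sup; first by exists (cdist (hfun f circ0) (hfun g circ0)), circ0.
by move=> _ [y _ <-].
Qed.

Lemma hball_measurable (f : @homeo R) e : measurable (hball f e : set (@homB R)).
Proof.
apply: sub_sigma_algebra => g; rewrite /hball /= => fg.
exists (e - hdist f g); first by rewrite subr_gt0.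
move=> h /= gh; apply: le_lt_trans (_ : hdist f g + hdist g h < e); last by lra.
apply: hdist_le => x; apply: le_trans (cdist_triangle (hfun g x) _ _) _.
by rewrite lerD ?hdist_ub.
Qed.

Lemma measurable_homP (u : @homB R -> @circB R) :
  (forall f e, 0 < e -> exists2 d, 0 < d & forall g, hdist f g < d -> cdist (u f) (u g) < e) ->
  measurable_fun setT u.
Proof.
move=> h; apply: measurable_circP => U oU; apply: sub_sigma_algebra => f /= Uf.
have [e e0 eU] := oU _ Uf; have [d d0 hd] := h f e e0.
by exists d => // g /= fg; apply/eU/hd.
Qed.

Lemma measurable_hfun x : measurable_fun setT (fun f : @homB R => hfun f x : @circB R).
Proof.
apply: measurable_homP => f e e0; exists e => // g; exact: le_lt_trans (hdist_ub _ _ _).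
Qed.

(** Evaluation of the inverse is continuous in the homeomorphism: g^-1 x = f^-1 (f (g^-1 x)), and f
    (g^-1 x) is within [hdist f g] of g (g^-1 x) = x. *)
Lemma measurable_hinv x : measurable_fun setT (fun f : @homB R => hinv f x : @circB R).
Proof.
apply: measurable_homP => f e e0; have [d d0 hd] := @hinv_cont _ f x e e0.
exists d => // g fg; rewrite -(hfunK f (hinv g x)); apply: hd.
by rewrite -{1}(hinvK g x) cdistC; apply: le_lt_trans fg; exact: hdist_ub.
Qed.

End Measurability.

(** * Resampling the first maps of a random sequence *)

Section Resampling.
Context {R : realType}.

Definition mix {T : Type} (n : nat) (u v : nat -> T) : nat -> T :=
  fun i => if (i < n)%N then u i else v (i - n)%N.

Lemma measurable_coord i : measurable_fun [set: @seqB R] (fun w : @seqB R => w i : @homB R).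
Proof.
move=> _ A mA; rewrite setTI; apply: sub_sigma_algebra; exists i, A.
by split.
Qed.

Lemma measurable_seqP d (T : measurableType d) (u : T -> @seqB R) :
  (forall i, measurable_fun setT (fun t => u t i : @homB R)) -> measurable_fun setT u.
Proof.
move=> h; apply: (@measurability _ _ _ (@seqB R) setT u (@cylinders R)) => //.
move=> _ [_ [i [A [mA ->]]] <-]; rewrite setTI.
exact: (measurable_preim (h i) mA).
Qed.

Lemma measurable_mix n :
  measurable_fun setT (fun p : @seqB R * @seqB R => mix n p.2 p.1 : @seqB R).
Proof.
apply: measurable_seqP => i; rewrite /mix; case: (i < n)%N.
- exact: (measurableT_comp (measurable_coord i) measurable_snd).
- exact: (measurableT_comp (measurable_coord (i - n)) measurable_fst).
Qed.

Definition rectangles : set (set (@seqB R)) := [set C | exists N (A : nat -> set (@homB R)),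
  (forall i, measurable (A i)) /\ C = [set w | forall i, (i < N)%N -> A i (w i)]].

Lemma rectangle_measurable C : rectangles C -> measurable C.
Proof.
move=> [N [A [mA ->]]].
rewrite (_ : [set w | _] = \bigcap_(i in [set i | (i < N)%N]) [set w : @seqB R | A i (w i)]).
  apply: bigcap_measurableType => i _.
  exact: (measurable_preim (measurable_coord i) (mA i)).
by apply/seteqP; split => w h i; exact: h.
Qed.

Lemma seqB_generated : (@measurable _ (@seqB R)) = <<s rectangles >>.
Proof.
apply/seteqP; split.
- apply: smallest_sub; first exact: smallest_sigma_algebra.
  move=> _ [i [A [mA ->]]]; apply: sub_sigma_algebra.
  exists i.+1, (fun k => if k == i then A else setT); split.
    by move=> k; case: ifP.
  apply/seteqP; split => w /= h; last by have := h i; rewrite eqxx ltnSn; exact.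
  by move=> k _; case: eqP => // ->.
- apply: smallest_sub; first exact: sigma_algebra_measurable.
  exact: rectangle_measurable.
Qed.

Lemma rectangles_setI : setI_closed rectangles.
Proof.
move=> _ _ [N [A [mA ->]]] [M [B [mB ->]]].
exists (maxn N M), (fun i => (if (i < N)%N then A i else setT) `&`
                       (if (i < M)%N then B i else setT)); split.
  by move=> i; apply: measurableI; case: ifP.
apply/seteqP; split => w /= => [[h1 h2] i _|h].
  by split; case: ifP => // hi; [exact: h1|exact: h2].
split => i hi; have := h i; rewrite leq_max hi ?orbT => /(_ isT) [] //.
Qed.

Variables (nu : probability (@homB R) R) (P : probability (@seqB R) R).
Hypothesis prodP : is_product_measure nu P.

(** Two independent sequences spliced at n have again the law P: both measures agree on
    [rectangles], which are closed under intersection and generate the product sigma-algebra. *)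
Lemma resample_set n (S : set (@seqB R)) : measurable S ->
  P S = ((P \x P) ((fun p : @seqB R * @seqB R => mix n p.2 p.1 : @seqB R) @^-1` S))%E.
Proof.
move=> mS; pose f := fun p : @seqB R * @seqB R => mix n p.2 p.1 : @seqB R.
have mf : measurable_fun setT f := measurable_mix n.
pose Q : measure (@seqB R) R :=
  measure_function_pushforward__canonical__measure_function_Measure (P \x P)%E mf.
have rT : rectangles setT.
  by exists 0%N, (fun=> setT); split => //; apply/seteqP; split.
apply: (@measure_unique _ R (@seqB R) rectangles (fun=> setT) seqB_generated rectangles_setI
  _ _ P Q) => //.
- by rewrite bigcup_const.
- move=> _ [N [A [mA ->]]].
  pose A' i := if (i < N)%N then A i else setT.
  have mA' i : measurable (A' i) by rewrite /A'; case: ifP.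
  have -> : [set w : seqB | forall i, (i < N)%N -> A i (w i)] =
            [set w : seqB | forall i, (i < n + N)%N -> A' i (w i)].
    apply/seteqP; split => w /= h i hi; first by rewrite /A'; case: ifP => // /h.
    by have := h i (ltn_addl _ hi); rewrite /A' hi.
  rewrite /Q /= /pushforward.
  transitivity (\prod_(i < n + N) nu (A' i))%E; first exact: prodP.
  have -> : f @^-1` [set w : seqB | forall i, (i < n + N)%N -> A' i (w i)] =
      [set w : seqB | forall i, (i < N)%N -> A' (n + i)%N (w i)] `*`
      [set w : seqB | forall i, (i < n)%N -> A' i (w i)].
    apply/seteqP; split => -[v u] /=.
      move=> h; split => i hi.
        by have := h (n + i)%N; rewrite ltn_add2l => /(_ hi); rewrite /f /= /mix ltnNge leq_addr /= addKn.
      by have := h i; rewrite /f /= /mix hi; apply; exact: ltn_addr.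
    move=> [h1 h2] i hi; rewrite /f /= /mix; case: ltnP => ni; first exact: h2.
    by have := h1 (i - n)%N; rewrite subnKC//; apply; rewrite ltn_subLR.
  rewrite product_measure1E.
  + rewrite big_split_ord /= muleC; congr (_ * _)%E; apply/esym; last exact: prodP.
    exact: (prodP N (fun i => mA' (n + i)%N)).
  + by apply: rectangle_measurable; exists N, (fun i => A' (n + i)%N).
  + by apply: rectangle_measurable; exists n, A'.
- by move=> k; apply: le_lt_trans (ltry 1); exact: probability_le1.
Qed.

Lemma measurable_section n (S : set (@seqB R)) : measurable S ->
  measurable_fun setT (fun v : @seqB R => P [set u : @seqB R | S (mix n u v)]).
Proof.
move=> mS; have mS' : measurable
    ((fun p : @seqB R * @seqB R => mix n p.2 p.1 : @seqB R) @^-1` S).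
  exact: (measurable_preim (measurable_mix n)).
have := measurable_fun_xsection P mS'; congr measurable_fun.
by apply/funext => v /=; congr (P _); apply/seteqP; split => u; rewrite /xsection /= inE.
Qed.

(** Fubini: the tail v is frozen in the outer integral, and the inner probability draws the first n
    maps anew. *)
Lemma resample n (S : set (@seqB R)) : measurable S ->
  P S = (\int[P]_v P [set u : @seqB R | S (mix n u v)])%E.
Proof.
move=> mS; rewrite (resample_set n mS) /product_measure1; apply: eq_integral => v _ /=.
by congr (P _); apply/seteqP; split => u; rewrite /xsection /= inE.
Qed.

End Resampling.

(** * The 2-variation and the contraction by disjoint blocks *)

Section FiniteSums.
Context {R : realType}.

Lemma sum_cauchy_schwarz (T : finType) (Q : pred T) (a b : T -> R) A B :
  \sum_(t | Q t) a t ^+ 2 <= A -> \sum_(t | Q t) b t ^+ 2 <= B ->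
  \sum_(t | Q t) a t * b t <= Num.sqrt (A * B).
Proof.
set p := \sum_(t | Q t) a t ^+ 2; set r := \sum_(t | Q t) b t ^+ 2.
set q := \sum_(t | Q t) a t * b t => pA rB.
have p0 : 0 <= p by apply: sumr_ge0 => t _; rewrite sqr_ge0.
have r0 : 0 <= r by apply: sumr_ge0 => t _; rewrite sqr_ge0.
have qpr : q ^+ 2 <= p * r.
  (* This sum of squares equals r (p r - q^2), which settles r > 0; for r = 0 every [b t] in the sum
     vanishes. *)
  have : 0 <= \sum_(t | Q t) (r * a t - q * b t) ^+ 2.
    by apply: sumr_ge0 => t _; rewrite sqr_ge0.
  have -> : \sum_(t | Q t) (r * a t - q * b t) ^+ 2 = r ^+ 2 * p - 2 * r * q * q + q ^+ 2 * r.
    rewrite /p [in LHS](eq_bigr (fun t => r ^+ 2 * a t ^+ 2 + (- (2 * r * q)) * (a t * b t)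
      + q ^+ 2 * b t ^+ 2)); last by move=> t _; ring.
    by rewrite !big_split /= -!mulr_sumr mulNr.
  have -> : r ^+ 2 * p - 2 * r * q * q + q ^+ 2 * r = r * (p * r - q ^+ 2) by ring.
  move: r0; rewrite le_eqVlt => /orP[/eqP r0 _|r0]; last by rewrite pmulr_rge0// subr_ge0.
  have -> : q = 0.
    apply: big1 => t Qt; have : b t ^+ 2 <= 0.
      by rewrite r0 /r (bigD1 t)//= lerDl sumr_ge0// => u _; rewrite sqr_ge0.
    by rewrite le_eqVlt ltNge sqr_ge0 orbF sqrf_eq0 => /eqP ->; rewrite mulr0.
  by rewrite -r0 mulr0 expr0n.
apply: le_trans (ler_norm q) _; rewrite -sqrtr_sqr ler_wsqrtr//.
by apply: le_trans qpr _; apply: ler_pM.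
Qed.

Lemma sum_unique_le1 (T : finType) (Q Z : pred T) :
  (forall t t', Q t -> Q t' -> Z t -> Z t' -> t = t') -> \sum_(t | Q t) (Z t)%:R <= 1 :> R.
Proof.
move=> h; case: (pickP (fun t => Q t && Z t)) => [t0 /andP[Q0 Z0]|hn]; last first.
  rewrite big1 // => t Qt; have := hn t; rewrite Qt /= => -> //.
rewrite (bigD1 t0)//= Z0 big1 ?addr0// => t /andP[Qt /eqP tt0].
by case Zt : (Z t) => //; case: tt0; exact: h.
Qed.

End FiniteSums.

(** * Separation functions of bounded 2-variation *)

Section VariationBound.
Context {R : realType}.
Implicit Types (F : @circ R -> @circ R -> R) (S s : R).

(* F has 2-variation at most sqrt S on the circle; phrasing it with disjoint
   connected sets instead of cyclically ordered points makes it invariant under homeomorphisms. *)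
Definition var2_le F S := forall (T : finType) (Q : pred T) (E : T -> set (@circ R)) (x y : T -> @circ R),
  (forall t, Q t -> [/\ cconn (E t), E t (x t) & E t (y t)]) ->
  (forall t t' z, Q t -> Q t' -> E t z -> E t' z -> t = t') ->
  \sum_(t | Q t) F (x t) (y t) ^+ 2 <= S.

Lemma var2_le_ge0 F S : var2_le F S -> 0 <= S.
Proof.
move=> /(_ unit pred0 (fun=> setT) (fun=> circ0) (fun=> circ0)); rewrite big_pred0 //.
by apply.
Qed.

Lemma var2_le_pair F S x y : var2_le F S -> F x y ^+ 2 <= S.
Proof.
move=> /(_ unit predT (fun=> setT) (fun=> x) (fun=> y)).
rewrite (big_pred1 tt); last by case.
by apply=> [t _|[] []//]; split => //; exact: cconnT.
Qed.

Definition split_at s (x y : @circ R) : bool := (sval x < s) != (sval y < s).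

(** A connected set split by the arc [0, s) contains [cproj 0] or [cproj s] by [cconn_lt_const], and
    each of these two points lies in at most one of the disjoint sets. *)
Lemma var2_le_split_at s : 0 <= s -> var2_le (fun x y => (split_at s x y)%:R) 2.
Proof.
move=> s0 T Q E x y hE dE.
have sum1 z : \sum_(t | Q t) (`[< E t z >])%:R <= 1 :> R.
  by apply: sum_unique_le1 => t t' Qt Qt' /asboolP h1 /asboolP h2; exact: (dE t t' z).
apply: le_trans (_ : \sum_(t | Q t) ((`[< E t (cproj 0) >])%:R + (`[< E t (cproj s) >])%:R) <= _); last first.
  by rewrite big_split /= (_ : 2 = 1 + 1)// lerD.
apply: ler_sum => t Qt; have [cE Ex Ey] := hE t Qt.
have [E0|E0] := asboolP (E t (cproj 0)).
  by apply: le_trans (_ : 1 <= _); [case: split_at; rewrite ?expr1n ?expr0n|rewrite lerDl].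
have [Es|Es] := asboolP (E t (cproj s)).
  by apply: le_trans (_ : 1 <= _); [case: split_at; rewrite ?expr1n ?expr0n|rewrite lerDr].
by rewrite /split_at (cconn_lt_const s0 cE E0 Es Ex Ey) eqxx expr0n addr0.
Qed.

Lemma ccontinuous_open (h : @circ R -> @circ R) (U : set (@circ R)) :
  ccontinuous h -> circ_open U -> circ_open (h @^-1` U).
Proof.
move=> ch oU x /= Ux; have [e e0 eU] := oU _ Ux; have [d d0 hd] := ch x e e0.
by exists d => // y xy; apply/eU/hd.
Qed.

Lemma cconn_image (h : @circ R -> @circ R) E : ccontinuous h -> cconn E -> cconn (h @` E).
Proof.
move=> ch cE U V oU oV hEUV dUV.
have [] := cE _ _ (ccontinuous_open ch oU) (ccontinuous_open ch oV).
- by move=> x Ex; apply: hEUV; exists x.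
- by move=> x Ex; apply: dUV; exists x.
- by move=> h1; left => _ [x Ex <-]; exact: h1.
- by move=> h1; right => _ [x Ex <-]; exact: h1.
Qed.

Lemma var2_le_comp (h : @circ R -> @circ R) F S : injective h -> ccontinuous h -> var2_le F S ->
  var2_le (fun x y => F (h x) (h y)) S.
Proof.
move=> ih ch vF T Q E x y hE dE.
apply: (vF T Q (fun t => h @` E t)) => [t Qt|t t' z Qt Qt' [u Eu <-] [u' Eu' /ih uu']].
  have [cE Ex Ey] := hE t Qt; split; first exact: cconn_image.
    by exists (x t).
  by exists (y t).
by apply: (dE t t' u) => //; rewrite -uu'.
Qed.

(* A block system: every block j contracts the complement of I j into J j; a j and b j
   carry the frontier of I j. *)
Record block_system (k : nat) (I J : 'I_k -> set (@circ R)) (a b : 'I_k -> @circ R) := BlockSystem {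
  bsI : forall j j' x, I j x -> I j' x -> j = j';
  bsJ : forall j j' x, J j x -> J j' x -> j = j';
  bsJc : forall j, cconn (J j);
  bsf : forall j E x y, cconn E -> ~ E (a j) -> ~ E (b j) -> E x -> E y -> I j x -> I j y }.

(** Applying [vF] to each block separately would give k sqrt(X S). The pairs (j, t) are instead
    sorted into five classes, each contributing at most sqrt(k X S) by Cauchy-Schwarz: either [E t]
    misses [I j] ([C1]), or [x t] or [y t] lies in [I j] ([C2], [C3]), or neither does and [E t]
    contains a frontier point [a j] or [b j] ([C4], [C5]). *)
Lemma blocks_bound (k : nat) (I J : 'I_k -> set (@circ R)) a b (h : 'I_k -> @circ R -> @circ R)
    F S (T : finType) (Q : pred T) (E : T -> set (@circ R)) (x y : T -> @circ R) (c : T -> R) X :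
  block_system I J a b ->
  (forall j, injective (h j)) -> (forall j, ccontinuous (h j)) ->
  (forall j z, ~ I j z -> J j (h j z)) ->
  (forall z z', 0 <= F z z') -> var2_le F S ->
  (forall t, Q t -> [/\ cconn (E t), E t (x t) & E t (y t)]) ->
  (forall t t' z, Q t -> Q t' -> E t z -> E t' z -> t = t') ->
  (forall t, 0 <= c t) -> \sum_(t | Q t) c t ^+ 2 = X ->
  \sum_(j < k) \sum_(t | Q t) c t * F (h j (x t)) (h j (y t)) <= 5 * Num.sqrt (k%:R * X * S).
Proof.
move=> bs ih ch hIJ F0 vF hE dE c0 Xe.
have X0 : 0 <= X by rewrite -Xe; apply: sumr_ge0 => t _; rewrite sqr_ge0.
have S0 := var2_le_ge0 vF.
pose G (p : 'I_k * T) := F (h p.1 (x p.2)) (h p.1 (y p.2)).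
pose g (p : 'I_k * T) := c p.2 * G p.
have g0 p : 0 <= g p by apply: mulr_ge0; [exact: c0|exact: F0].
rewrite (@pair_big_dep _ _ _ _ _ xpredT (fun _ t => Q t) (fun j t => g (j, t))) /=.
have -> : \sum_(p : 'I_k * T | Q p.2) g (p.1, p.2) = \sum_(p | Q p.2) g p.
  by apply: eq_bigr => -[].
pose C1 (p : 'I_k * T) := `[< forall z, E p.2 z -> I p.1 z -> False >].
pose C2 (p : 'I_k * T) := `[< I p.1 (x p.2) >].
pose C3 (p : 'I_k * T) := `[< I p.1 (y p.2) >].
pose D (p : 'I_k * T) := `[< ~ I p.1 (x p.2) /\ ~ I p.1 (y p.2) >].
pose C4 (p : 'I_k * T) := D p && `[< E p.2 (a p.1) >].
pose C5 (p : 'I_k * T) := D p && `[< E p.2 (b p.1) >].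
have cover p : Q p.2 -> [|| C1 p, C2 p, C3 p, C4 p | C5 p].
  case: p => j t /= Qt; have [cE Ex Ey] := hE t Qt.
  rewrite /C1 /C2 /C3 /C4 /C5 /D /=.
  case: asboolP => //= /existsNP[z /not_implyP[Ez /contrapT Iz]].
  case: asboolP => //= nx; case: asboolP => //= ny.
  rewrite (asboolT (conj nx ny)) /=.
  case: asboolP => //= na; case: asboolP => //= nb.
  by case: nx; apply: (bsf bs cE na nb Ez Ex Iz).
have split5 : \sum_(p | Q p.2) g p <= \sum_(p | Q p.2 && C1 p) g p + \sum_(p | Q p.2 && C2 p) g p
   + \sum_(p | Q p.2 && C3 p) g p + \sum_(p | Q p.2 && C4 p) g p + \sum_(p | Q p.2 && C5 p) g p.
  rewrite !big_mkcondr /= -!big_split /=; apply: ler_sum => p Qp.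
  have := cover p Qp; have := g0 p; move: (g p) => gp.
  by case: (C1 p); case: (C2 p); case: (C3 p); case: (C4 p); case: (C5 p) => //= *; lra.
apply: le_trans split5 _.
have sumc (C : pred ('I_k * T)) : \sum_(p | Q p.2 && C p) c p.2 ^+ 2 <= k%:R * X.
  apply: le_trans (_ : \sum_(p : 'I_k * T | Q p.2) c p.2 ^+ 2 <= _).
    rewrite big_mkcondr /=; apply: ler_sum => p _; case: ifP => // _; exact: sqr_ge0.
  rewrite -(@pair_big_dep _ _ _ _ _ xpredT (fun _ t => Q t) (fun _ t => c t ^+ 2)) /=.
  by rewrite Xe sumr_const card_ord mulr_natl.
(* A point lies in at most one [I j], so in [C2] and [C3] the squares of c are counted at most once
   per t: their sum loses the factor k. *)
have sumc1 (u : T -> @circ R) :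
    \sum_(p | Q p.2 && `[< I p.1 (u p.2) >]) c p.2 ^+ 2 <= X.
  rewrite -(@pair_big_dep _ _ _ _ _ xpredT (fun j t => Q t && `[< I j (u t) >])
     (fun _ t => c t ^+ 2)) /=.
  rewrite (exchange_big_dep Q) /=; last by move=> j t _ /andP[].
  rewrite -Xe; apply: ler_sum => t Qt; rewrite Qt /=.
  rewrite big_mkcond /= (eq_bigr (fun j => c t ^+ 2 * (`[< I j (u t) >])%:R)); last first.
    by move=> j _; case: asboolP => _; rewrite ?mulr1 ?mulr0.
  rewrite -mulr_sumr ler_piMr ?sqr_ge0//.
  by apply: sum_unique_le1 => j j' _ _ /asboolP h1 /asboolP h2; exact: (bsI bs h1 h2).
have sumG (C : pred ('I_k * T)) : \sum_(p | Q p.2 && C p) G p ^+ 2 <= k%:R * S.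
  apply: le_trans (_ : \sum_(p : 'I_k * T | Q p.2) G p ^+ 2 <= _).
    rewrite big_mkcondr /=; apply: ler_sum => p _; case: ifP => // _; exact: sqr_ge0.
  rewrite -(@pair_big_dep _ _ _ _ _ xpredT (fun _ t => Q t) (fun j t => G (j, t) ^+ 2)) /=.
  have -> : k%:R * S = \sum_(j < k) S by rewrite sumr_const card_ord mulr_natl.
  apply: ler_sum => j _; exact: (var2_le_comp (ih j) (ch j) vF hE dE).
have e5 (z : R) : 5 * z = z + z + z + z + z by ring.
rewrite e5 !lerD //.
(* On [C1] the images of [E t] under [h j] are disjoint over all pairs, by injectivity for equal j
   and by disjointness of the [J j] otherwise, so [vF] bounds the sum of all squares of G at once by
   S. *)
- apply: (sum_cauchy_schwarz (sumc C1)).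
  apply: (vF _ _ (fun p => h p.1 @` E p.2)) => [[j t] /andP[/= Qt _]|].
    have [cE Ex Ey] := hE t Qt; split; first exact: cconn_image.
      by exists (x t).
    by exists (y t).
  move=> [j t] [j' t'] z /andP[/= Qt /asboolP C1t] /andP[/= Qt' /asboolP C1t'].
  move=> [u Eu uz] [u' Eu' uz'].
  have jj' : j = j'.
    by apply: (bsJ bs (x := z)); [rewrite -uz|rewrite -uz']; apply: hIJ => /=; [exact: C1t|exact: C1t'].
  subst j'; congr pair; have uu' : u = u' by apply: (ih j); rewrite uz.
  by apply: (dE t t' u) => //; rewrite uu'.
- by rewrite (mulrAC _ X) mulrC; apply: sum_cauchy_schwarz; [exact: sumc1|exact: sumG].
- by rewrite (mulrAC _ X) mulrC; apply: sum_cauchy_schwarz; [exact: sumc1|exact: sumG].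
(* Both images lie in [J j], which now serves as the connected set. It is used for one t only, since
   [a j] lies in at most one [E t]. *)
- apply: (sum_cauchy_schwarz (sumc C4)).
  apply: (vF _ _ (fun p => J p.1)) => [[j t] /and3P[/= Qt /asboolP[/= h1 h2] _]|].
    by split; [exact: (bsJc bs)|exact: hIJ|exact: hIJ].
  move=> [j t] [j' t'] z /and3P[/= Qt _ /asboolP /= E1] /and3P[/= Qt' _ /asboolP /= E2] z1 z2.
  have jj' := bsJ bs z1 z2; subst j'; congr pair; exact: dE E1 E2.
- apply: (sum_cauchy_schwarz (sumc C5)).
  apply: (vF _ _ (fun p => J p.1)) => [[j t] /and3P[/= Qt /asboolP[/= h1 h2] _]|].
    by split; [exact: (bsJc bs)|exact: hIJ|exact: hIJ].
  move=> [j t] [j' t'] z /and3P[/= Qt _ /asboolP /= E1] /and3P[/= Qt' _ /asboolP /= E2] z1 z2.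
  have jj' := bsJ bs z1 z2; subst j'; congr pair; exact: dE E1 E2.
Qed.

End VariationBound.

(** * Averages over random homeomorphisms *)

Section Averaging.
Context {R : realType} d (T : measurableType d) (P : probability T R).
Variable h : T -> @circ R -> @circ R.
Hypothesis hinj : forall v, injective (h v).
Hypothesis hcont : forall v, ccontinuous (h v).
Variables (F G : @circ R -> @circ R -> R) (S : R).
Hypothesis F0 : forall x y, 0 <= F x y.
Hypothesis mF : forall x y, measurable_fun setT (fun v => F (h v x) (h v y)).
Hypothesis GE : forall x y, ((G x y)%:E = \int[P]_v (F (h v x) (h v y))%:E)%E.
Hypothesis vF : var2_le F S.

Lemma average_ge0 x y : 0 <= G x y.
Proof. by rewrite -lee_fin GE; apply: integral_ge0 => v _; rewrite lee_fin. Qed.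

Section Family.
Variables (I : finType) (Q : pred I) (x y : I -> @circ R) (c : I -> R).
Hypothesis c0 : forall t, 0 <= c t.

(** For c t = G (x t) (y t) its integral is the sum of the squares G (x t) (y t)^2, which thereby
    becomes linear in the averaged function. *)
Definition combination v := \sum_(t | Q t) c t * F (h v (x t)) (h v (y t)).

Lemma combination_ge0 v : 0 <= combination v.
Proof. by apply: sumr_ge0 => t _; rewrite mulr_ge0. Qed.

Lemma measurable_combination : measurable_fun setT combination.
Proof.
rewrite /combination; under eq_fun do rewrite big_mkcond.
apply: measurable_sum => t; case: (Q t) => //.
by apply: measurable_funM => //; exact: mF.
Qed.

Lemma integral_combination :
  (\int[P]_v (combination v)%:E = (\sum_(t | Q t) c t * G (x t) (y t))%:E)%E.
Proof.
rewrite (eq_integral (fun v => (\sum_(t <- index_enum I)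
   (if Q t then c t * F (h v (x t)) (h v (y t)) else 0)%:E)%E)); last first.
  by move=> v _; rewrite /combination sumEFin -big_mkcond.
rewrite ge0_integral_sum//.
- rewrite -sumEFin [RHS]big_mkcond /=; apply: eq_bigr => t _.
  case: (Q t); last by rewrite integral0.
  under eq_integral do rewrite EFinM.
  rewrite ge0_integralZl_EFin//; first by rewrite -GE EFinM.
    by move=> v _; rewrite lee_fin.
  by apply/measurable_EFinP; exact: mF.
- move=> t; apply/measurable_EFinP; case: (Q t) => //.
  by apply: measurable_funM => //; exact: mF.
- by move=> t v _; rewrite lee_fin; case: (Q t) => //; rewrite mulr_ge0.
Qed.

End Family.

(** After Cauchy-Schwarz the sum of squares X appears on both sides; squaring and cancelling one
    factor X removes it from the right. *)
Lemma le_of_le_sqrt (X lam : R) : 0 <= X -> 0 <= S -> X <= lam * Num.sqrt (X * S) ->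
  X <= lam ^+ 2 * S.
Proof.
move=> X0 S0 h1; have [->|Xn0] := eqVneq X 0; first by rewrite mulr_ge0// sqr_ge0.
have X1 : 0 < X by rewrite lt_neqAle eq_sym Xn0.
have : X ^+ 2 <= (lam * Num.sqrt (X * S)) ^+ 2 by rewrite lerXn2r// nnegrE (le_trans X0).
by rewrite exprMn sqr_sqrtr ?mulr_ge0// expr2 (mulrC X S) mulrA ler_pM2r.
Qed.

Lemma combination_le (I : finType) (Q : pred I) (E : I -> set (@circ R)) (x y : I -> @circ R) c v :
  (forall t, Q t -> [/\ cconn (E t), E t (x t) & E t (y t)]) ->
  (forall t t' z, Q t -> Q t' -> E t z -> E t' z -> t = t') ->
  combination Q x y c v <= Num.sqrt ((\sum_(t | Q t) c t ^+ 2) * S).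
Proof.
move=> hE dE; apply: sum_cauchy_schwarz => //.
exact: (var2_le_comp (@hinj v) (hcont v) vF hE dE).
Qed.

Lemma var2_le_average : var2_le G S.
Proof.
move=> I Q E x y hE dE; pose c t := G (x t) (y t).
have c0 t : 0 <= c t by exact: average_ge0.
rewrite -[S]mul1r -[X in X * S](expr1n _ 2).
apply: le_of_le_sqrt; [by apply: sumr_ge0 => t _; rewrite sqr_ge0|exact: var2_le_ge0 vF|].
rewrite mul1r; set M := Num.sqrt _.
rewrite -lee_fin.
have -> : \sum_(t | Q t) G (x t) (y t) ^+ 2 = \sum_(t | Q t) c t * G (x t) (y t).
  by apply: eq_bigr => t _; rewrite expr2.
rewrite -integral_combination//.
apply: le_trans (_ : (\int[P]_v cst M%:E v <= _)%E); last first.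
  by rewrite integral_cst// [X in (_ * X)%E](_ : _ = 1%E) ?mule1//; exact: probability_setT.
apply: ge0_le_integral => //.
- by move=> v _; rewrite lee_fin combination_ge0.
- by apply/measurable_EFinP; exact: measurable_combination.
- by move=> v _; rewrite lee_fin; exact: (combination_le _ _ hE dE).
Qed.

Variables (J1 J2 : 'I_36 -> set (@circ R)) (a b : 'I_36 -> @circ R).
Hypothesis bs : block_system J1 J2 a b.
Variables (B : 'I_36 -> set T) (eps : R).
Hypothesis mB : forall j, measurable (B j).
Hypothesis dB : forall j j' v, B j v -> B j' v -> j = j'.
Hypothesis eps0 : 0 < eps.
Hypothesis PB : forall j, (eps%:E <= P (B j))%E.
Hypothesis hB : forall j v z, B j v -> ~ J1 j z -> J2 j (h v z).

(** [blocks_bound] concerns one map from each block, so each supremum is replaced by a value that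
    misses it by at most e / 36. The events [B j] are nonempty because they have positive
    probability. *)
Lemma sum_sup_le (Y : T -> R) M K : (forall v, Y v <= M) ->
  (forall v : 'I_36 -> T, (forall j, B j (v j)) -> \sum_j Y (v j) <= K) ->
  \sum_j sup [set Y v | v in B j] <= K.
Proof.
move=> YM hK.
have hs j : has_sup [set Y v | v in B j].
  split; last by exists M => _ [v _ <-].
  have [B0|/set0P[v Bv]] := eqVneq (B j) set0; last by exists (Y v), v.
  have : (P (B j) <= 0)%E by rewrite B0 measure0.
  by move/(le_trans (PB j)); rewrite lee_fin leNgt eps0.
apply/ler_addgt0Pr => e e0; have e36 : 0 < e / 36 by rewrite divr_gt0.
have ex j : exists v, B j v /\ sup [set Y v | v in B j] - e / 36 < Y v.
  by have [_ [v Bv <-] h1] := sup_adherent e36 (hs j); exists v.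
have [v hv] := choice ex.
have h1 := hK v (fun j => (hv j).1).
apply: le_trans (_ : \sum_j (Y (v j) + e / 36) <= _).
  by apply: ler_sum => j _; have := (hv j).2; lra.
have e36E : e / 36 *+ 36 = e by rewrite -[LHS]mulr_natr mulfVK.
by rewrite big_split /= sumr_const card_ord e36E lerD2r.
Qed.

(** Pointwise Y <= M. For one map from each of the 36 blocks, [blocks_bound] gives the sum 5 * 6 * M
    = 30 M in place of 36 M. As each block has probability at least eps, the integral of Y falls
    short of M by at least 6 eps M. *)
Lemma var2_le_contract : var2_le G ((1 - 6 * eps) ^+ 2 * S).
Proof.
move=> I Q E x y hE dE; pose c t := G (x t) (y t).
have c0 t : 0 <= c t by exact: average_ge0.
have S0 := var2_le_ge0 vF.
set X := \sum_(t | Q t) _.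
have X0 : 0 <= X by apply: sumr_ge0 => t _; rewrite sqr_ge0.
apply: le_of_le_sqrt => //; set M := Num.sqrt _.
pose Y := combination Q x y c.
have YM v : Y v <= M by exact: (combination_le _ _ hE dE).
pose s j := sup [set Y v | v in B j].
have Ys j v : B j v -> Y v <= s j.
  move=> Bv; apply: sup_upper_bound; last by exists v.
  by split; [exists (Y v), v|exists M => _ [u _ <-]].
have sM j : s j <= M.
  apply: sup_le_ub; last by move=> _ [u _ <-].
  have [B0|/set0P[v Bv]] := eqVneq (B j) set0; last by exists (Y v), v.
  have : (P (B j) <= 0)%E by rewrite B0 measure0.
  by move/(le_trans (PB j)); rewrite lee_fin leNgt eps0.
have s30 : \sum_j s j <= 30 * M.
  apply: (sum_sup_le YM) => v Bv.
  have := blocks_bound bs (fun j => @hinj (v j)) (fun j => hcont (v j))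
     (fun j z => hB (Bv j)) F0 vF hE dE c0 erefl.
  rewrite -/X -mulrA sqrtrM ?ler0n// -/M.
  rewrite (_ : 36 = 6 ^+ 2 :> R); last by ring.
  by rewrite sqrtr_sqr ger0_norm// mulrA (_ : 5 * 6 = 30 :> R) //; ring.
have XY : (X%:E = \int[P]_v (Y v)%:E)%E.
  by rewrite integral_combination//; congr EFin; apply: eq_bigr => t _; rewrite expr2.
(* On [B j] the deficit M - s j is added to Y. The disjointness of the blocks keeps Z <= M, and the
   integral of Z exceeds X by the sum of (M - s j) P (B j). *)
pose Z v := Y v + \sum_j (M - s j) * \1_(B j) v.
have ZM v : Z v <= M.
  rewrite /Z; have [[j Bj]|nB] := pselect (exists j, B j v).
    rewrite (bigD1 j)//= big1 ?addr0; last first.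
      move=> j' j'j; rewrite indicE memNset ?mulr0// => Bj'.
      by move: j'j; rewrite (dB Bj' Bj) eqxx.
    by rewrite indicE mem_set// mulr1; have := Ys j v Bj; lra.
  rewrite big1 ?addr0// => j _; rewrite indicE memNset ?mulr0// => Bj; apply: nB; by exists j.
have mYE : measurable_fun setT (fun v => (Y v)%:E).
  by apply/measurable_EFinP; exact: measurable_combination.
have mIE j : measurable_fun setT (fun v => ((M - s j) * \1_(B j) v)%:E).
  by apply/measurable_EFinP; apply: measurable_funM => //; exact: measurable_indic.
have IE0 j v : (0 <= ((M - s j) * \1_(B j) v)%:E)%E.
  by rewrite lee_fin mulr_ge0// ?subr_ge0// indicE.
have ZE : (\int[P]_v (Z v)%:E = X%:E + \sum_j (M - s j)%:E * P (B j))%E.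
  rewrite (eq_integral (fun v => (Y v)%:E + \sum_j ((M - s j) * \1_(B j) v)%:E)%E); last first.
    by move=> v _; rewrite /Z EFinD sumEFin.
  rewrite ge0_integralD//.
  - rewrite XY; congr (_ + _)%E; rewrite ge0_integral_sum//; apply: eq_bigr => j _.
    under eq_integral do rewrite EFinM.
    rewrite ge0_integralZl_EFin ?subr_ge0//.
    + by rewrite integral_indic// setIT.
    + by apply/measurable_EFinP; exact: measurable_indic.
  - by move=> v _; rewrite lee_fin combination_ge0.
  - by move=> v _; apply: sume_ge0.
  - exact: emeasurable_sum.
have ZleM : (\int[P]_v (Z v)%:E <= M%:E)%E.
  apply: le_trans (_ : (\int[P]_v cst M%:E v <= _)%E); last first.
    by rewrite integral_cst// [X in (_ * X)%E](_ : _ = 1%E) ?mule1//; exact: probability_setT.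
  apply: ge0_le_integral => //.
  - move=> v _; rewrite lee_fin addr_ge0 ?combination_ge0//.
    by apply: sumr_ge0 => j _; rewrite -lee_fin.
  - have -> : (fun v => (Z v)%:E) = (fun v => (Y v)%:E + \sum_j ((M - s j) * \1_(B j) v)%:E)%E.
      by apply/funext => v; rewrite /Z EFinD sumEFin.
    by apply: emeasurable_funD => //; exact: emeasurable_sum.
  - by move=> v _; rewrite lee_fin.
have : (X%:E + \sum_j (M - s j)%:E * eps%:E <= M%:E)%E.
  apply: le_trans ZleM; rewrite ZE; apply: leeD => //.
  by apply: lee_sum => j _; apply: lee_wpmul2l => //; rewrite lee_fin subr_ge0.
under eq_bigr do rewrite -EFinM.
rewrite sumEFin -EFinD lee_fin -mulr_suml big_split /= sumrN sumr_const card_ord -[M *+ 36]mulr_natr.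
have : (M * 36 - 30 * M) * eps <= (M * 36 - \sum_j s j) * eps.
  by rewrite ler_pM2r//; lra.
by nra.
Qed.

End Averaging.

(** * Exponential decay and convergence of the random walk *)

Section RealEstimates.
Context {R : realType}.

(** Turns a contraction by lam in m steps into a rate per step: rho = 1 - (1 - lam) / m works by
    Bernoulli's inequality. *)
Lemma bernoulli_root (lam : R) (m : nat) : 0 < lam -> lam < 1 -> (0 < m)%N ->
  exists rho, [/\ 0 < rho, rho < 1 & lam <= rho ^+ m].
Proof.
move=> l0 l1 m0; have m1 : 0 < m%:R :> R by rewrite ltr0n.
pose dlt := (1 - lam) / m%:R.
have d0 : 0 < dlt by rewrite divr_gt0// subr_gt0.
have d1 : dlt < 1.
  rewrite ltr_pdivrMr// mul1r; apply: lt_le_trans (_ : 1 <= _); first by lra.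
  by rewrite ler1n.
have B k : 1 - k%:R * dlt <= (1 - dlt) ^+ k.
  elim: k => [|k IH]; first by rewrite mul0r subr0 expr0.
  rewrite exprS; apply: le_trans (_ : (1 - dlt) * (1 - k%:R * dlt) <= _).
    have : 0 <= k%:R * dlt * dlt by exact: (mulr_ge0 (mulr_ge0 (ler0n _ k) (ltW d0)) (ltW d0)).
    by rewrite -natr1; lra.
  by rewrite ler_pM2l// subr_gt0.
exists (1 - dlt); split; [by rewrite subr_gt0|by lra|].
apply: le_trans (B m); rewrite /dlt mulrC divfK ?gt_eqF//; lra.
Qed.

Lemma geometric_sum_le (C rho : R) n : 0 <= C -> 0 < rho -> rho < 1 ->
  \sum_(0 <= i < n) C * rho ^+ i <= C / (1 - rho).
Proof.
move=> C0 r0 r1; have := @geometric_seriesE R C rho.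
rewrite lt_eqF// => /(_ isT)/(congr1 (fun f => f n)); rewrite /series /= => ->.
rewrite -mulrA ler_wpM2l// ler_piMl ?invr_ge0 ?subr_ge0 ?(ltW r1)//.
by rewrite lerBlDr lerDl exprn_ge0// ltW.
Qed.

Lemma borel_cantelli_geometric d (T : measurableType d) (P : probability T R)
    (A : nat -> set T) C rho : 0 <= C -> 0 < rho -> rho < 1 ->
  (forall n, measurable (A n)) -> (forall n, (P (A n) <= (C * rho ^+ n)%:E)%E) ->
  {ae P, forall w, exists N, forall n, (N <= n)%N -> ~ A n w}.
Proof.
move=> C0 r0 r1 mA PA.
exists (lim_sup_set A); split.
- apply: bigcap_measurableType => n _; exact: bigcup_measurable.
- apply: lim_sup_set_cvg0 => //.
  apply: le_lt_trans (ltry (C / (1 - rho))).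
  apply: lime_le; first exact: is_cvg_nneseries.
  apply: nearW => n; apply: le_trans (_ : (\sum_(0 <= i < n) (C * rho ^+ i)%:E <= _)%E).
    by apply: lee_sum => i _; exact: PA.
  by rewrite sumEFin lee_fin geometric_sum_le.
- move=> w hw n _ /=; apply: contrapT => hn; apply: hw; exists n => k nk Ak.
  by apply: hn; exists k.
Qed.

End RealEstimates.

(** * Convergence from eventually constant positions *)

Section Convergence.
Context {R : realType}.
Implicit Types u : nat -> @circ R.

Lemma eventually_forall_lt (Q : nat -> nat -> Prop) (M : nat) :
  (forall i, exists K, forall n, (K <= n)%N -> Q i n) ->
  exists K, forall i n, (i < M)%N -> (K <= n)%N -> Q i n.
Proof.
move=> h; elim: M => [|M [K hK]]; first by exists 0%N.
have [K' hK'] := h M; exists (maxn K K') => i n; rewrite ltnS leq_eqVlt geq_max.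
by move=> /orP[/eqP ->|iM] /andP[h1 h2]; [exact: hK'|exact: hK].
Qed.

Definition threshold (N i : nat) : R := i%:R / N.+1%:R.

Lemma split_at_ge1 s (x y : @circ R) : 1 <= s -> split_at s x y = false.
Proof.
by move=> s1; rewrite /split_at (lt_le_trans (circ_lt1 x) s1) (lt_le_trans (circ_lt1 y) s1).
Qed.

Lemma threshold_dist N (x y : @circ R) : (forall i, (i < N.+1)%N -> ~~ split_at (threshold N i) x y) ->
  `|sval x - sval y| <= N.+1%:R^-1.
Proof.
move=> h; apply: cell_dist => // i; apply/eqP; rewrite -[_ == _]negbK.
have [iN|Ni] := ltnP i N.+1; first exact: h.
by rewrite -/(split_at (threshold N i) x y) split_at_ge1// ler_pdivlMr// mul1r ler_nat.
Qed.

(** For every N the sequence finally stays in one cell of length 1/(N+1), so its coordinates are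
    Cauchy. The limit is written as a limsup, a formula that makes sense for every sequence and
    depends measurably on it. *)
Lemma ccvg_of_eventually_const u :
  (forall N i, exists K, forall n, (K <= n)%N -> ~~ split_at (threshold N i) (u n) (u n.+1)) ->
  ccvg u (cproj (limn_sup (fun n => sval (u n)))).
Proof.
move=> h.
have cl N : exists K, forall n, (K <= n)%N -> `|sval (u n) - sval (u K)| <= N.+1%:R^-1.
  have [K hK] := eventually_forall_lt N.+1 (h N); exists K => n Kn.
  apply: threshold_dist => i iN; rewrite -(subnKC Kn).
  elim: (n - K)%N => [|k IH]; first by rewrite addn0 /split_at eqxx.
  move: IH (hK i (K + k)%N iN (leq_addr _ _)); rewrite /split_at !negbK addnS.
  by move=> /eqP <- /eqP <-.
have /cvg_ex[/= l ul] : cvgn (fun n => sval (u n) : R).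
  apply/cauchy_cvgP/cauchy_exP => e e0.
  have := near_infty_natSinv_lt (PosNum e0) => -[N _ /(_ N (leqnn N)) /= Ne].
  have [K hK] := cl N; exists (sval (u K)); exists K => // n Kn /=.
  by rewrite /ball /= distrC; apply: le_lt_trans (hK n Kn) Ne.
rewrite (cvg_limn_inf_sup ul).2.
apply/circ_cvgP => e e0; move/cvgrPdist_lt : ul => /(_ e e0) [K _ hK].
exists K => n Kn; rewrite -(cproj_sval (u n)).
by apply: le_lt_trans (cdist_cproj _ _) _; rewrite distrC; apply: hK.
Qed.

Lemma ccvg_close u v l : ccvg u l ->
  (forall N i, exists K, forall n, (K <= n)%N -> ~~ split_at (threshold N i) (v n) (u n)) ->
  ccvg v l.
Proof.
move=> /circ_cvgP ul h; apply/circ_cvgP => e e0.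
have := near_infty_natSinv_lt (PosNum (divr2_gt0 e0)) => -[N _ /(_ N (leqnn N)) /= Ne].
have [K hK] := eventually_forall_lt N.+1 (h N).
have [K' hK'] := ul _ (divr2_gt0 e0).
exists (maxn K K') => n; rewrite geq_max => /andP[Kn K'n].
apply: le_lt_trans (cdist_triangle (u n) _ _) _; rewrite [e]splitr; apply: ltrD; last exact: hK'.
apply: le_lt_trans Ne; apply: le_trans (cdist_le_dist _ _) _.
by apply: threshold_dist => i iN; exact: hK.
Qed.

End Convergence.

(** * Decay of separation and almost sure limits of the walk *)

Section Walk.
Context {R : realType}.
Variable act : @homeo R -> @circ R -> @circ R.

(** With [act] equal to [hfun] or [hinv] this is [lcomp] or [linv], so that one argument yields both
    limits. Each new map is composed on the inside. *)
Fixpoint walk (w : nat -> @homeo R) (n : nat) : @circ R -> @circ R :=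
  if n is m.+1 then walk w m \o act (w m) else id.

Lemma walk_mix_le n m (u v : nat -> @homeo R) : (m <= n)%N -> walk (mix n u v) m = walk u m.
Proof. by elim: m => //= m IH mn; rewrite IH ?(ltnW mn)// /mix mn. Qed.

Lemma walk_mix n m (u v : nat -> @homeo R) x :
  walk (mix n u v) (n + m) x = walk u n (walk v m x).
Proof.
elim: m x => [|m IH] x; first by rewrite addn0 walk_mix_le.
by rewrite addnS /= IH /mix ltnNge leq_addr /= addKn.
Qed.

Hypothesis act_inj : forall f, injective (act f).
Hypothesis act_cont : forall f, ccontinuous (act f).
Hypothesis act_meas : forall x, measurable_fun setT (fun f : @homB R => act f x : @circB R).

Lemma walk_inj w n : injective (walk w n).
Proof. by elim: n => [|n IH]; [exact: inj_id|exact: inj_comp]. Qed.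

Lemma ccontinuous_comp (f g : @circ R -> @circ R) :
  ccontinuous f -> ccontinuous g -> ccontinuous (f \o g).
Proof.
move=> cf cg x e e0; have [d d0 hd] := cf (g x) e e0.
by have [d' d'0 hd'] := cg x d d0; exists d' => // y xy; apply/hd/hd'.
Qed.

Lemma walk_cont w n : ccontinuous (walk w n).
Proof.
elim: n => [|n IH]; first exact: id_ccont.
exact: ccontinuous_comp.
Qed.

Lemma measurable_walk n x : measurable_fun setT (fun w : @seqB R => walk w n x : @circB R).
Proof.
elim: n x => [|n IH] x; first exact: measurable_cst.
apply: (@measurable_caratheodory _ _ _ (fun w : @seqB R => walk w n : _ -> @circB R)
  (fun w : @seqB R => act (w n) x)) => //.
- by move=> w; exact: walk_cont.
- exact: (measurableT_comp (act_meas x) (measurable_coord n)).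
Qed.

Lemma measurable_split_at d (T : measurableType d) s (u v : T -> @circB R) :
  measurable_fun setT u -> measurable_fun setT v ->
  measurable [set t | split_at s (u t) (v t)].
Proof.
move=> mu mv.
have m1 (z : T -> @circB R) : measurable_fun setT z -> measurable [set t | sval (z t) < s].
  move=> mz; have := measurable_preim (measurableT_comp measurable_sval mz)
    (measurable_itv `]-oo, s[).
  by congr measurable; apply/seteqP; split => t /=; rewrite in_itv.
rewrite (_ : [set t | _] = ([set t | sval (u t) < s] `\` [set t | sval (v t) < s]) `|`
   ([set t | sval (v t) < s] `\` [set t | sval (u t) < s])).
  by apply: measurableU; apply: measurableD; exact: m1.
apply/seteqP; split => t /=; rewrite /split_at.
  by case: (sval (u t) < s); case: (sval (v t) < s) => //= _; [left|right].
by case: (sval (u t) < s); case: (sval (v t) < s) => //= -[[]|[]].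
Qed.

Variables (nu : probability (@homB R) R) (P : probability (@seqB R) R).
Hypothesis prodP : is_product_measure nu P.

Definition sep_prob s n x y : R := fine (P [set w : @seqB R | split_at s (walk w n x) (walk w n y)]).

Lemma sep_probE s n x y :
  (sep_prob s n x y)%:E = P [set w : @seqB R | split_at s (walk w n x) (walk w n y)].
Proof.
by rewrite /sep_prob fineK// fin_num_measure//; apply: measurable_split_at; exact: measurable_walk.
Qed.

Lemma sep_prob_ge0 s n x y : 0 <= sep_prob s n x y.
Proof. by rewrite -lee_fin sep_probE. Qed.

Lemma measurable_sep_set s n m x y :
  measurable [set w : @seqB R | split_at s (walk w n x) (walk w m y)].
Proof. by apply: measurable_split_at; exact: measurable_walk. Qed.

Lemma mix_sepE s n m x y v :
  (sep_prob s n (walk v m x) (walk v m y))%:E =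
  P [set u : @seqB R | split_at s (walk (mix n u v) (n + m) x) (walk (mix n u v) (n + m) y)].
Proof. by rewrite sep_probE; congr (P _); apply/seteqP; split => u /=; rewrite !walk_mix. Qed.

Lemma sep_prob_rec s n m x y :
  ((sep_prob s (n + m) x y)%:E = \int[P]_v (sep_prob s n (walk v m x) (walk v m y))%:E)%E.
Proof.
rewrite sep_probE (resample prodP n (measurable_sep_set s (n + m) (n + m) x y)).
by apply: eq_integral => v _; rewrite mix_sepE.
Qed.

Lemma measurable_sep_prob s n m x y :
  measurable_fun setT (fun v : @seqB R => sep_prob s n (walk v m x) (walk v m y)).
Proof.
apply/measurable_EFinP.
rewrite (_ : _ \o _ = fun v => P [set u : @seqB R |
   split_at s (walk (mix n u v) (n + m) x) (walk (mix n u v) (n + m) y)]).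
  exact: (measurable_section P n (measurable_sep_set s (n + m) (n + m) x y)).
by apply/funext => v /=; rewrite mix_sepE.
Qed.

Lemma sep_prob0 s x y : sep_prob s 0 x y = (split_at s x y)%:R.
Proof.
rewrite /sep_prob /=; case: (split_at s x y).
  rewrite (_ : [set w | _] = setT); last by apply/seteqP; split.
  by rewrite probability_setT.
rewrite (_ : [set w | _] = set0); last by apply/seteqP; split.
by rewrite measure0.
Qed.

Lemma var2_le_sep_prob s n : 0 <= s -> var2_le (sep_prob s n) 2.
Proof.
move=> s0; have v0 : var2_le (sep_prob s 0) 2.
  have -> : sep_prob s 0 = fun x y => (split_at s x y)%:R.
    by apply/funext => x; apply/funext => y; exact: sep_prob0.
  exact: var2_le_split_at.
apply: (@var2_le_average _ _ _ P (fun v => walk v n) (fun v => @walk_inj v n)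
  (fun v => @walk_cont v n) (sep_prob s 0)) => //.
- exact: sep_prob_ge0.
- exact: measurable_sep_prob.
- exact: (sep_prob_rec s 0 n).
Qed.

(** More than 25 blocks make 5 / sqrt k smaller than 1, and 36 is a square. The bound eps <= 1/36
    keeps the factor 1 - 6 eps positive. *)
Definition contracting_blocks := exists (m : nat) (I J : 'I_36 -> set (@circ R))
    (a b : 'I_36 -> @circ R) (B : 'I_36 -> set (@seqB R)) (eps : R),
  [/\ (0 < m)%N, block_system I J a b, 0 < eps <= 1 / 36 &
   [/\ forall j, measurable (B j), forall j j' v, B j v -> B j' v -> j = j',
       forall j, (eps%:E <= P (B j))%E &
       forall j v z, B j v -> ~ I j z -> J j (walk v m z)]].

Hypothesis blocks : contracting_blocks.

(** For n = q m + r, start from the 2-variation bound at time r and contract q times; [var2_le_pair]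
    turns the result into a bound for single pairs. *)
Lemma sep_prob_decay : exists C rho, [/\ 0 <= C, 0 < rho, rho < 1 &
  forall s n x y, 0 <= s -> sep_prob s n x y <= C * rho ^+ n].
Proof.
have [m [I [J [a [b [B [eps [m0 bs /andP[e0 e1] [mB dB PB hB]]]]]]]]] := blocks.
pose lam := 1 - 6 * eps.
have l0 : 0 < lam by rewrite /lam; lra.
have l1 : lam < 1 by rewrite /lam; lra.
have v s q r : 0 <= s -> var2_le (sep_prob s (r + q * m)) ((lam ^+ q) ^+ 2 * 2).
  move=> s0; elim: q => [|q IH].
    by rewrite mul0n addn0 expr0 expr1n mul1r; exact: var2_le_sep_prob.
  rewrite mulSn addnA addnAC (exprS lam q) exprMn -mulrA.
  apply: (@var2_le_contract _ _ _ P (fun v => walk v m) (fun v => @walk_inj v m)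
   (fun v => @walk_cont v m) (sep_prob s (r + q * m)) _ _ _ _ _ IH _ _ _ _ bs B _ mB dB e0 PB hB).
  - exact: sep_prob_ge0.
  - exact: measurable_sep_prob.
  - exact: sep_prob_rec.
have [rho [r0 r1 lr]] := bernoulli_root l0 l1 m0.
(* Here p <= 2 lam^q <= 2 rho^(q m), and dividing by rho^m pays for the fewer than m remaining
   steps. *)
exists (2 / rho ^+ m), rho; split => //; first by rewrite divr_ge0// exprn_ge0// ltW.
move=> s n x y s0; rewrite {1}(divn_eq n m) addnC.
have := var2_le_pair x y (v s (n %/ m)%N (n %% m)%N s0).
set p := sep_prob _ _ _ _; set lq := lam ^+ _ => h.
have lq0 : 0 < lq by rewrite exprn_gt0.
have pl : p <= 2 * lq.
  have : p ^+ 2 <= (2 * lq) ^+ 2 by apply: (le_trans h); rewrite exprMn; nra.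
  by rewrite ler_sqr// nnegrE ?sep_prob_ge0// mulr_ge0// ltW.
apply: (le_trans pl); rewrite -mulrA ler_pM2l// mulrC ler_pdivlMr ?exprn_gt0//.
apply: le_trans (_ : rho ^+ m ^+ (n %/ m) * rho ^+ m <= _).
  by rewrite ler_pM2r ?exprn_gt0// lerXn2r// nnegrE ?exprn_ge0// ltW.
rewrite -exprM -exprD [X in _ <= _ ^+ X](divn_eq n m) mulnC.
by apply: ler_wiXn2l; rewrite ?ltW// leq_add2l ltnW// ltn_mod.
Qed.

(** Conditionally on the map of step n + 1, the event compares the positions of two fixed points, x
    and [act (v 0%N) x], under an independent walk of n steps. The uniform decay makes its
    probabilities summable. *)
Lemma walk_step_const s x : 0 <= s ->
  {ae P, forall w : @seqB R, exists N, forall n, (N <= n)%N -> ~~ split_at s (walk w n x) (walk w n.+1 x)}.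
Proof.
move=> s0; have [C [rho [C0 r0 r1 h]]] := sep_prob_decay.
have := @borel_cantelli_geometric _ _ _ P
  (fun n => [set w : @seqB R | split_at s (walk w n x) (walk w n.+1 x)]) _ _ C0 r0 r1
  (fun n => measurable_sep_set s n n.+1 x x).
have hP n : (P [set w : @seqB R | split_at s (walk w n x) (walk w n.+1 x)] <= (C * rho ^+ n)%:E)%E.
  rewrite (resample prodP n (measurable_sep_set s n n.+1 x x)).
  rewrite (eq_integral (fun v : @seqB R => (sep_prob s n x (act (v 0%N) x))%:E)); last first.
    move=> v _; rewrite sep_probE; congr (P _); apply/seteqP; split => u /=.
      by rewrite walk_mix_le// /mix ltnn subnn.
    by rewrite walk_mix_le// /mix ltnn subnn.
  apply: le_trans (_ : (\int[P]_v (cst (C * rho ^+ n)%:E v) <= _)%E); last first.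
    by rewrite integral_cst// [X in (_ * X)%E](_ : _ = 1%E) ?mule1//; exact: probability_setT.
  apply: ge0_le_integral => //.
  - by move=> v _; rewrite lee_fin sep_prob_ge0.
  - rewrite (_ : (fun _ => _) = fun v => P [set u : @seqB R |
       split_at s (walk (mix n u v) n x) (walk (mix n u v) n.+1 x)]).
      exact: (measurable_section P n (measurable_sep_set s n n.+1 x x)).
    apply/funext => v; rewrite sep_probE; congr (P _); apply/seteqP; split => u /=.
      by rewrite walk_mix_le// /mix ltnn subnn.
    by rewrite walk_mix_le// /mix ltnn subnn.
  - by move=> v _; rewrite lee_fin; exact: h.
move=> /(_ hP); apply: filterS => w [N hN]; exists N => n Nn; apply/negP; exact: hN.
Qed.

Lemma walk_pair_const s x y : 0 <= s ->
  {ae P, forall w : @seqB R, exists N, forall n, (N <= n)%N -> ~~ split_at s (walk w n x) (walk w n y)}.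
Proof.
move=> s0; have [C [rho [C0 r0 r1 h]]] := sep_prob_decay.
have := @borel_cantelli_geometric _ _ _ P
  (fun n => [set w : @seqB R | split_at s (walk w n x) (walk w n y)]) _ _ C0 r0 r1
  (fun n => measurable_sep_set s n n x y).
have hP n : (P [set w : @seqB R | split_at s (walk w n x) (walk w n y)] <= (C * rho ^+ n)%:E)%E.
  by rewrite -sep_probE lee_fin; exact: h.
move=> /(_ hP); apply: filterS => w [N hN]; exists N => n Nn; apply/negP; exact: hN.
Qed.

Lemma walk_limit : exists pi : @seqB R -> @circB R, measurable_fun setT pi /\
  forall x, {ae P, forall w : @seqB R, ccvg (fun n => walk w n x) (pi w)}.
Proof.
(* The orbit of [circ0] defines the limit; any other orbit converges to the same point because
   almost surely no rational threshold separates the two orbits infinitely often. *)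
pose lim (w : @seqB R) := limn_sup (fun n => sval (walk w n circ0)).
exists (fun w => cproj (lim w)); split.
  apply: (measurableT_comp measurable_cproj).
  apply: measurable_fun_limn_sup => [w _|w _|n].
  - by exists 1 => _ [n _ <-]; exact/ltW/circ_lt1.
  - by exists 0 => _ [n _ <-]; exact: circ_ge0.
  - exact: (measurableT_comp measurable_sval (measurable_walk n circ0)).
have t0 N i : 0 <= threshold N i :> R by rewrite divr_ge0.
have l0 : {ae P, forall w : @seqB R, ccvg (fun n => walk w n circ0) (cproj (lim w))}.
  have h : {ae P, forall (w : @seqB R) N i, exists K, forall n, (K <= n)%N ->
      ~~ split_at (threshold N i) (walk w n circ0) (walk w n.+1 circ0)}.
    exact: (ae_foralln (fun N => ae_foralln (fun i => walk_step_const circ0 (t0 N i)))).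
  by move: h; apply: filterS => w h; exact: ccvg_of_eventually_const.
move=> x.
have h : {ae P, forall (w : @seqB R) N i, exists K, forall n, (K <= n)%N ->
      ~~ split_at (threshold N i) (walk w n x) (walk w n circ0)}.
  exact: (ae_foralln (fun N => ae_foralln (fun i => walk_pair_const x circ0 (t0 N i)))).
by move: l0 h; apply: filterS2 => w; exact: ccvg_close.
Qed.

End Walk.

(** * Contracting words in a proximal semigroup *)

Section Compactness.
Context {R : realType}.

(** Compactness of [0, 1]: points chosen at the scales 1/(n+1) have a cluster point, and
    monotonicity in e transfers them to coarser scales. Later extractions of limit points use this
    form. *)
Lemma circ_cluster (Q : R -> @circ R -> Prop) :
  (forall e e' x, e <= e' -> Q e x -> Q e' x) -> (forall e, 0 < e -> exists x, Q e x) ->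
  exists q, forall e, 0 < e -> exists2 x, Q e x & cdist x q < e.
Proof.
move=> mQ hQ.
have ex n : exists x, Q n.+1%:R^-1 x by apply: hQ; rewrite invr_gt0.
have [a ha] := choice ex.
have [|l [_ cl]] := @segment_compact R 0 1 ((fun n => sval (a n) : R) @ \oo) _.
  by exists 0%N => // n _ /=; rewrite in_itv /= circ_ge0 ltW ?circ_lt1.
exists (cproj l) => e e0.
have := near_infty_natSinv_lt (PosNum e0) => -[N _ hN].
have [||_ [[n Nn <-] nl]] := cl [set sval (a n) | n in [set n | (N <= n)%N]] (ball l e).
- by exists N => // n /= Nn; exists n.
- exact: nbhsx_ballx.
exists (a n); first by apply: mQ (ha n); exact/ltW/hN.
by rewrite -(cproj_sval (a n)); apply: le_lt_trans (cdist_cproj _ _) _; rewrite distrC.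
Qed.

Lemma ccontinuous_uniform (f : @circ R -> @circ R) e : ccontinuous f -> 0 < e ->
  exists2 d, 0 < d & forall x y, cdist x y < d -> cdist (f x) (f y) < e.
Proof.
move=> cf e0; apply: contrapT => hn.
have [|d d0|q hq] := @circ_cluster (fun d x => exists2 y, cdist x y < d & e <= cdist (f x) (f y)).
- by move=> d d' x dd' [y xy h]; exists y => //; exact: lt_le_trans xy dd'.
- apply: contrapT => hx; apply: hn; exists d => // x y xy; rewrite ltNge; apply/negP => h.
  by apply: hx; exists x, y.
have [d d0 hd] := cf q _ (divr2_gt0 e0).
have [x [y xy]] := hq _ (divr2_gt0 d0); rewrite leNgt => /negP h xq; apply: h.
apply: le_lt_trans (cdist_triangle (f q) _ _) _; rewrite [e]splitr; apply: ltrD.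
- by rewrite cdistC; apply: hd; rewrite cdistC; lra.
- apply: hd; apply: le_lt_trans (cdist_triangle x _ _) _.
  by rewrite cdistC [d]splitr ltrD.
Qed.

Lemma uniform_separation (s : seq (@circ R)) :
  exists2 d, 0 < d & forall x y, x \in s -> y \in s -> x <> y -> d <= cdist x y.
Proof.
suff [d d0 h] : exists2 d, 0 < d & forall p, p \in [seq (x, y) | x <- s, y <- s] ->
    p.1 <> p.2 -> d <= cdist p.1 p.2.
  by exists d => // x y xs ys; apply: (h (x, y)); apply/allpairsP; exists (x, y).
elim: [seq _ | _ <- _, _ <- _] => [|[x y] l [d d0 hd]]; first by exists 1.
have [xy|xy] := pselect (x = y).
  exists d => // p; rewrite inE => /orP[/eqP ->//|]; exact: hd.
exists (Num.min d (cdist x y)); first by rewrite lt_min d0 cdist_gt0.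
move=> p; rewrite inE => /orP[/eqP -> _|pl pp]; first by rewrite /= ge_min lexx orbT.
by rewrite ge_min hd.
Qed.

Lemma uniform_lower_bound (n : nat) (f : 'I_n -> R) : (forall j, 0 < f j) ->
  exists2 d, 0 < d & forall j, d <= f j.
Proof.
move=> f0; exists (\big[Num.min/1]_j f j).
  by elim/big_ind: _ => // x y x0 y0; rewrite lt_min x0.
by move=> j; rewrite (bigD1 j)//= ge_min lexx.
Qed.

End Compactness.

(** * From proximality to contracting words *)

Section ContractingWords.
Context {R : realType}.
Variable X : set (@homeo R).
Let Gam := gen_semigroup X.
Hypothesis prox : proximal Gam.
Hypothesis nofix : fixes_no_point Gam.
Implicit Types (g h : @circ R -> @circ R) (p q x y : @circ R).

Lemma semigroup_homeo g : Gam g ->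
  exists2 g', cancel g g' /\ cancel g' g & ccontinuous g /\ ccontinuous g'.
Proof.
elim=> [f _|g1 g2 _ [h1 [K1 K1'] [c1 c1']] _ [h2 [K2 K2'] [c2 c2']]].
  exists (hinv f); split; [exact: hfunK|exact: hinvK|exact: hfun_cont|exact: hinv_cont].
exists (h2 \o h1); split; [exact: can_comp|exact: can_comp| |]; exact: ccontinuous_comp.
Qed.

Lemma semigroup_cont g : Gam g -> ccontinuous g.
Proof. by case/semigroup_homeo => g' _ []. Qed.

Lemma semigroup_inj g : Gam g -> injective g.
Proof. by case/semigroup_homeo => g' [gK _] _; exact: can_inj gK. Qed.

Lemma proximal_lt x y e : 0 < e -> exists2 g, Gam g & cdist (g x) (g y) < e.
Proof.
move=> e0; have [g [Gg /cvgrPdist_lt /(_ e e0) [N _ hN]]] := prox x y.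
exists (g N) => //; have := hN N (leqnn N).
by rewrite /= sub0r normrN ger0_norm ?cdist_ge0.
Qed.

(** Induction on the list: let g bring the old points near q and, after an extraction, x0 near q'.
    Proximality gives h that brings q and q' together, and h o g then gathers all points. A last
    extraction makes the target independent of e. *)
Lemma collapse_seq (s : seq (@circ R)) : exists q, forall e, 0 < e ->
  exists2 g, Gam g & forall x, x \in s -> cdist (g x) q < e.
Proof.
elim: s => [|x0 s [q hq]].
  by exists circ0 => e e0; have [g Gg _] := proximal_lt circ0 circ0 ltr01; exists g.
have [|e e0|q' hq'] := @circ_cluster R (fun e a => exists2 g, Gam g /\ a = g x0 &
    forall x, x \in s -> cdist (g x) q < e).
- by move=> e e' a ee' [g Gg h]; exists g => // x xs; exact: lt_le_trans (h x xs) ee'.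
- by have [g Gg h] := hq e e0; exists (g x0), g.
have [|e e0|q'' hq''] := @circ_cluster R (fun e a => exists2 g, Gam g &
    forall x, x \in x0 :: s -> cdist (g x) a < e).
- by move=> e e' a ee' [g Gg h]; exists g => // x xs; exact: lt_le_trans (h x xs) ee'.
- have e2 := divr2_gt0 e0; have [h Gh hqq'] := proximal_lt q q' e2.
  have [d d0 hd] := semigroup_cont Gh q e2; have [d' d'0 hd'] := semigroup_cont Gh q' e2.
  have [|_ [g [Gg ->] hg] gq'] := hq' (Num.min d d'); first by rewrite lt_min d0.
  exists (h q), (h \o g); first exact: sg_comp.
  move=> x; rewrite inE => /orP[/eqP ->|xs] /=.
    apply: le_lt_trans (cdist_triangle (h q') _ _) _; rewrite [e]splitr; apply: ltrD.
      by rewrite cdistC; apply: hd'; rewrite cdistC; apply: lt_le_trans gq' _; rewrite ge_min lexx orbT.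
    by rewrite cdistC.
  apply: lt_le_trans (_ : e / 2 <= _); last by lra.
  rewrite cdistC; apply: hd; rewrite cdistC.
  by apply: lt_le_trans (hg x xs) _; rewrite ge_min lexx.
exists q'' => e e0; have [a [g Gg hg] aq] := hq'' _ (divr2_gt0 e0); exists g => // x xs.
apply: le_lt_trans (cdist_triangle a _ _) _; rewrite [e]splitr; apply: ltrD => //; exact: hg.
Qed.

(* p is a repelling and q an attracting point of some limit of elements of the semigroup. *)
Definition contracting_pair p q := forall e, 0 < e -> exists2 g, Gam g &
  forall x, e <= cdist x p -> cdist (g x) q < e.

(** If g collapses a fine grid into a small ball about q, the preimage of the complement of that
    ball is connected and misses the grid, so it lies near a single point p. Two extractions fix
    first p and then q. *)
Lemma contracting_pair_exists : exists p q, contracting_pair p q.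
Proof.
have [|e e0|p hp] := @circ_cluster R (fun e p => exists q, exists2 g, Gam g &
    forall x, e <= cdist x p -> cdist (g x) q < e).
- move=> e e' p ee' [q [g Gg h]]; exists q, g => // x xp.
  by apply: (lt_le_trans _ ee'); apply: h; exact: le_trans ee' xp.
- have := near_infty_natSinv_lt (PosNum e0) => -[N _ /(_ N (leqnn N)) /= Ne].
  have [q hq] := collapse_seq [seq grid N.+1 i | i <- iota 0 N.+1].
  have [g Gg hg] := hq e e0; have [g' [gK g'K] [_ cg']] := semigroup_homeo Gg.
  have [[z zq]|hn] := pselect (exists z, ~ cball q e z); last first.
    by exists q, q, g => // x _; apply: contrapT => h; apply: hn; exists (g x).
  exists (g' z), q, g => // x; rewrite leNgt => /negP xz; apply: contrapT => gx; apply: xz.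
  apply: le_lt_trans Ne.
  apply: (@cconn_grid R N.+1 (g' @` (~` cball q e))) => //.
  + by apply: cconn_image => //; exact: cconn_cballC.
  + move=> i iN [u uq uE]; apply: uq; rewrite -(g'K u) uE; apply: hg.
    by apply/mapP; exists i => //; rewrite mem_iota.
  + by exists (g x) => //; exact: gK.
have [|e e0|q hq] := @circ_cluster R (fun e q => exists2 g, Gam g &
    forall x, e <= cdist x p -> cdist (g x) q < e).
- move=> e e' q ee' [g Gg h]; exists g => // x xp.
  by apply: (lt_le_trans _ ee'); apply: h; exact: le_trans ee' xp.
- have [p' [q [g Gg h]] pp'] := hp _ (divr2_gt0 e0); exists q, g => // x xp.
  apply: lt_le_trans (h x _) _; last by lra.
  by have := cdist_triangle p' x p; lra.
exists p, q => e e0; have [q' [g Gg h] qq'] := hq _ (divr2_gt0 e0); exists g => // x xp.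
have xp' : e / 2 <= cdist x p by lra.
by have := h x xp'; have := cdist_triangle q' (g x) q; lra.
Qed.

Lemma contracting_pair_attract p q h : Gam h -> contracting_pair p q -> contracting_pair p (h q).
Proof.
move=> Gh pq e e0; have [d d0 hd] := semigroup_cont Gh q e0.
have [|g Gg hg] := pq (Num.min d e); first by rewrite lt_min d0.
exists (h \o g); first exact: sg_comp.
move=> x xp /=; rewrite cdistC; apply: hd; rewrite cdistC.
apply: lt_le_trans (_ : Num.min d e <= _); last by rewrite ge_min lexx.
by apply: hg; rewrite ge_min xp orbT.
Qed.

Lemma contracting_pair_repel p q h : Gam h -> contracting_pair (h p) q -> contracting_pair p q.
Proof.
move=> Gh pq e e0; have [h' [hK h'K] [_ ch']] := semigroup_homeo Gh.
have [d d0 hd] := ch' (h p) e e0.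
have [|g Gg hg] := pq (Num.min d e); first by rewrite lt_min d0.
exists (g \o h); first exact: sg_comp.
move=> x xp /=; apply: lt_le_trans (_ : Num.min d e <= _); last by rewrite ge_min lexx orbT.
apply: hg; rewrite leNgt; apply/negP => hx.
have := hd (h x); rewrite !hK => hd1.
have : cdist p x < e.
  by apply: hd1; rewrite cdistC; apply: lt_le_trans hx _; rewrite ge_min lexx.
by rewrite cdistC ltNge xp.
Qed.

(** If q differs from p', a contraction towards q followed by one away from p' works, as a small
    ball about q stays away from p'. Otherwise some h moves q, since q is not fixed, and h q
    replaces q. *)
Lemma contracting_pair_mix p q p' q' :
  contracting_pair p q -> contracting_pair p' q' -> contracting_pair p q'.
Proof.
wlog qp' : q / q <> p'.
  move=> W pq pq'; have [qp'|] := pselect (q = p'); last by move=> h; exact: W h pq pq'.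
  have [h [Gh hq]] : exists h, Gam h /\ h q <> p'.
    apply: contrapT => hn; apply: nofix; exists q => f Gf.
    by apply: contrapT => fq; apply: hn; exists f; split => //; rewrite -qp'.
  by apply: (W _ hq) => //; exact: contracting_pair_attract.
move=> pq pq' e e0; pose d := cdist q p' / 2.
have d0 : 0 < d by apply: divr2_gt0; exact: cdist_gt0.
have [|g' Gg' hg'] := pq' (Num.min d e); first by rewrite lt_min d0.
have [|g Gg hg] := pq (Num.min d e); first by rewrite lt_min d0.
exists (g' \o g); first exact: sg_comp.
move=> x xp /=; apply: lt_le_trans (_ : Num.min d e <= _); last by rewrite ge_min lexx orbT.
apply: hg'; have : cdist (g x) q < d.
  apply: lt_le_trans (_ : Num.min d e <= _); last by rewrite ge_min lexx.
  by apply: hg; rewrite ge_min xp orbT.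
rewrite ge_min; have := cdist_triangle (g x) q p'; rewrite (cdistC q (g x)) /d => h1 h2.
by apply/orP; left; lra.
Qed.

(** Two points of s cannot approach closer than the least gap of s, against proximality; if x is the
    only point, it is fixed. *)
Lemma no_finite_invariant (s : seq (@circ R)) x : x \in s ->
  (forall g z, Gam g -> z \in s -> g z \in s) -> False.
Proof.
move=> xs hs; have [[y ys yx]|hn] := pselect (exists2 y, y \in s & y <> x).
  have [d d0 hd] := uniform_separation s.
  have [g Gg] := proximal_lt y x d0; rewrite ltNge => /negP; apply.
  by apply: hd; [exact: hs|exact: hs|move/(semigroup_inj Gg)].
apply: nofix; exists x => f Gf; apply: contrapT => fx; apply: hn; exists (f x) => //; exact: hs.
Qed.

(** The inverse of g maps the finite set s into itself injectively, hence onto, so s is forward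
    invariant too. *)
Lemma no_finite_backward_invariant (s : seq (@circ R)) x : uniq s -> x \in s ->
  (forall g z, Gam g -> g z \in s -> z \in s) -> False.
Proof.
move=> us xs hs; apply: (no_finite_invariant xs) => g z Gg zs.
have [g' [gK g'K] _] := semigroup_homeo Gg.
have us' : uniq (map g' s) by rewrite map_inj_uniq//; exact: can_inj g'K.
have sub : {subset map g' s <= s}.
  by move=> _ /mapP[u us0 ->]; apply: (hs g) => //; rewrite g'K.
have [_ eqs] := uniq_min_size us' sub ltac:(by rewrite size_map).
have : z \in map g' s by rewrite eqs.
by move/mapP => [u us0 ->]; rewrite g'K.
Qed.

Lemma infinite_points (L : set (@circ R)) x0 : L x0 ->
  (forall s : seq (@circ R), uniq s -> (forall x, L x <-> x \in s) -> False) ->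
  forall n, exists s : seq (@circ R), [/\ uniq s, size s = n & forall x, x \in s -> L x].
Proof.
move=> Lx0 hL; elim=> [|n [s [us ss sL]]]; first by exists [::].
have [[x Lx xs]|hn] := pselect (exists2 x, L x & x \notin s).
  exists (x :: s); rewrite /= xs us ss; split => // y; rewrite inE => /orP[/eqP ->//|]; exact: sL.
exfalso; apply: (hL s us) => x; split; last exact: sL.
by move=> Lx; apply: contrapT => /negP xs; apply: hn; exists x.
Qed.

(** Repelling points are closed under preimages and attracting points under images, so neither form
    a finite set. Choosing 2n attracting points leaves n outside [ps], and [contracting_pair_mix]
    allows arbitrary pairing. *)
Lemma contracting_points n : exists (ps qs : seq (@circ R)),
  [/\ uniq (ps ++ qs), size ps = n, size qs = n &
      forall p q, p \in ps -> q \in qs -> contracting_pair p q].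
Proof.
have [p0 [q0 pq0]] := contracting_pair_exists.
have [|s us hs|ps [ups sps hps]] := @infinite_points (fun p => exists q, contracting_pair p q) p0 _ _ n.
- by exists q0.
- apply: (@no_finite_backward_invariant s p0) => //; first by apply/hs; exists q0.
  move=> g z Gg /hs [q zq]; apply/hs; exists q; exact: contracting_pair_repel zq.
have [|s us hs|qs [uqs sqs hqs]] := @infinite_points (fun q => exists p, contracting_pair p q) q0 _ _ (n + n)%N.
- by exists p0.
- apply: (@no_finite_invariant s q0); first by apply/hs; exists p0.
  move=> g z Gg /hs [p pz]; apply/hs; exists p; exact: contracting_pair_attract.
pose qs' := [seq q <- qs | q \notin ps].
have sqs' : (n <= size qs')%N.
  have h1 : (size [seq q <- qs | q \in ps] <= n)%N.
    rewrite -sps; apply: uniq_leq_size; first exact: filter_uniq.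
    by move=> x; rewrite mem_filter => /andP[].
  have := count_predC (fun q => q \in ps) qs; rewrite sqs -!size_filter.
  rewrite (_ : size [seq x <- qs | predC _ x] = size qs') //.
  by move=> h2; rewrite -(leq_add2l n) -h2 leq_add2r.
exists ps, (take n qs'); split => //.
- rewrite cat_uniq ups take_uniq ?filter_uniq// andbT /=.
  by apply/hasPn => x /mem_take; rewrite mem_filter => /andP[].
- by rewrite size_takel.
- move=> p q /hps[q1 pq1] /mem_take; rewrite mem_filter => /andP[_ /hqs[p1 pq2]].
  exact: contracting_pair_mix pq1 pq2.
Qed.

Definition word m g := exists2 ws : nat -> @homeo R, forall i, X (ws i) & walk (@hfun R) ws m = g.

Lemma word_cat m n g h : word m g -> word n h -> word (m + n) (g \o h).
Proof.
move=> [u Xu <-] [v Xv <-]; exists (mix m u v).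
  by move=> i; rewrite /mix; case: ifP.
by apply/funext => x; rewrite walk_mix.
Qed.

Lemma word_iter m g k : word m g -> word (k * m) (iter k g).
Proof.
move=> mg; elim: k => [|k IH].
  by have [ws Xws _] := mg; exists ws.
by rewrite mulSn; exact: (word_cat mg IH).
Qed.

Lemma word_of_semigroup g : Gam g -> exists2 m, (0 < m)%N & word m g.
Proof.
elim=> [f Xf|g1 g2 _ [m m0 w1] _ [n n0 w2]].
  by exists 1%N => //; exists (fun=> f).
by exists (m + n)%N; [rewrite addn_gt0 m0|exact: word_cat].
Qed.

Lemma walk_close ws m e : 0 < e -> exists2 eta, 0 < eta &
  forall w, (forall i, (i < m)%N -> hdist (ws i) (w i) < eta) ->
  forall x, cdist (walk (@hfun R) ws m x) (walk (@hfun R) w m x) < e.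
Proof.
elim: m e => [|m IH] e e0; first by exists 1 => // w _ x; rewrite /= cdistxx.
have e2 := divr2_gt0 e0; have [eta eta0 h] := IH _ e2.
have cw : ccontinuous (walk (@hfun R) ws m) by apply: walk_cont => f; exact: hfun_cont.
have [d d0 hd] := ccontinuous_uniform cw e2.
exists (Num.min eta d); first by rewrite lt_min eta0.
move=> w hw x /=; apply: le_lt_trans (cdist_triangle (walk (@hfun R) ws m (hfun (w m) x)) _ _) _.
rewrite [e]splitr; apply: ltrD.
- apply: hd; apply: le_lt_trans (hdist_ub _ _ _) _.
  by apply: lt_le_trans (hw m (ltnSn m)) _; rewrite ge_min lexx orbT.
- apply: h => i im; apply: lt_le_trans (hw i (ltnW im)) _; by rewrite ge_min lexx.
Qed.

Lemma contracting_words n : exists (M : nat) (p q : 'I_n -> @circ R) (e eta : R)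
    (ws : 'I_n -> nat -> @homeo R),
  [/\ (0 < M)%N, 0 < e, 0 < eta & [/\
   forall j j' x, cball (p j) e x -> cball (p j') e x -> j = j',
   forall j j' x, cball (q j) e x -> cball (q j') e x -> j = j',
   forall j j' x, cball (p j) e x -> cball (q j') e x -> False,
   forall j i, X (ws j i) &
   forall j w, (forall i, (i < M)%N -> hdist (ws j i) (w i) < eta) ->
     forall x, ~ cball (p j) e x -> cball (q j) e (walk (@hfun R) w M x)]].
Proof.
have [ps [qs [upq sp sq hpq]]] := contracting_points n.
have [d d0 hd] := uniform_separation (ps ++ qs).
(* Balls of radius d / 2 about the chosen points are disjoint. The words contract at scale e / 2,
   which leaves e / 2 for perturbing their letters. *)
pose e := d / 2; have e0 : 0 < e by exact: divr2_gt0.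
have e2 : 0 < e / 2 by exact: divr2_gt0.
pose p (j : 'I_n) := nth circ0 ps j; pose q (j : 'I_n) := nth circ0 qs j.
have pp j : p j \in ps by rewrite mem_nth// sp.
have qq j : q j \in qs by rewrite mem_nth// sq.
have ppq j : p j \in ps ++ qs by rewrite mem_cat pp.
have qpq j : q j \in ps ++ qs by rewrite mem_cat qq orbT.
move: (upq); rewrite cat_uniq => /and3P[ups /hasPn hn uqs].
have dis x y z : x \in ps ++ qs -> y \in ps ++ qs -> cball x e z -> cball y e z -> x = y.
  rewrite /cball /= => xs ys zx zy; apply: contrapT => /(hd _ _ xs ys).
  by have := cdist_triangle z x y; rewrite (cdistC x z) /e in zx zy *; lra.
have pneq j j' : p j <> q j' by move=> h; have /negP := hn _ (qq j'); apply; rewrite -h.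
have step1 j : exists g, [/\ Gam g & forall x, e / 2 <= cdist x (p j) -> cdist (g x) (q j) < e / 2].
  by have [g Gg h] := hpq _ _ (pp j) (qq j) _ e2; exists g.
have [g hg] := choice step1.
have step2 j : exists m, (0 < m)%N /\ word m (g j).
  by have [Gg _] := hg j; have [m m0 mg] := word_of_semigroup Gg; exists m.
have [m hm] := choice step2.
(* A common multiple of the word lengths: each [g j] is iterated up to length M. *)
pose M := (\prod_j m j)%N.
have M0 : (0 < M)%N by apply: prodn_gt0 => j; have [] := hm j.
have step3 j : exists ws : nat -> @homeo R, (forall i, X (ws i)) /\
    forall x, e / 2 <= cdist x (p j) -> cdist (walk (@hfun R) ws M x) (q j) < e / 2.
  have [k kM] : exists k, M = (k * m j)%N by exists (\prod_(i | i != j) m i)%N; rewrite mulnC /M (bigD1 j).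
  have k0 : (0 < k)%N by case: k kM M0 => // ->.
  have [ws Xws wE] := word_iter k (hm j).2; exists ws; split => // x xp.
  (* After one application the point is within e / 2 of [q j], which is at least 2 e away from
     [p j], so the contraction of [g j] applies again. *)
  rewrite kM wE; case: k k0 {kM wE} => // k _; elim: k => [|k IH]; first exact: (hg j).2.
  rewrite iterS; apply: (hg j).2; have := hd _ _ (ppq j) (qpq j) (@pneq j j).
  have := cdist_triangle (iter k.+1 (g j) x) (p j) (q j).
  by rewrite (cdistC (p j) (iter _ _ _)) /e in IH *; lra.
have [ws hws] := choice step3.
have step4 j : exists eta, 0 < eta /\ forall w, (forall i, (i < M)%N -> hdist (ws j i) (w i) < eta) ->
    forall x, cdist (walk (@hfun R) (ws j) M x) (walk (@hfun R) w M x) < e / 2.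
  by have [eta eta0 h] := walk_close (ws j) M e2; exists eta.
have [etas hetas] := choice step4.
have [eta eta0 heta] := uniform_lower_bound (fun j => (hetas j).1).
exists M, p, q, e, eta, ws; split => //; split.
- move=> j j' x h1 h2; apply/val_inj/eqP; rewrite -(nth_uniq circ0 _ _ ups) ?sp ?ltn_ord//.
  by apply/eqP; exact: (dis (p j) (p j') x).
- move=> j j' x h1 h2; apply/val_inj/eqP; rewrite -(nth_uniq circ0 _ _ uqs) ?sq ?ltn_ord//.
  by apply/eqP; exact: (dis (q j) (q j') x).
- by move=> j j' x h1 h2; apply: (@pneq j j'); exact: (dis _ _ x).
- by move=> j i; have [] := hws j.
- move=> j w hw x /negP; rewrite /cball /= -leNgt => xp.
  have h1 := (hetas j).2 w (fun i iM => lt_le_trans (hw i iM) (heta j)) x.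
  have xp2 : e / 2 <= cdist x (p j) by lra.
  have h2 := (hws j).2 x xp2.
  by have := cdist_triangle (walk (@hfun R) (ws j) M x) (walk (@hfun R) w M x) (q j);
    rewrite (cdistC (walk _ w M x) (walk _ _ M x)); lra.
Qed.

End ContractingWords.

(** * Diameters, the shift and the blocks of the two walks *)

Section Diameter.
Context {R : realType}.

Lemma cdiam_ge0 (A : set (@circ R)) : 0 <= cdiam A.
Proof.
have [->|/set0P[x Ax]] := eqVneq A set0.
  rewrite /cdiam (_ : [set _ | _ in _ & _ in _] = set0) ?sup0//.
  by apply/seteqP; split => // _ [x []].
apply: sup_upper_bound; last by exists x => //; exists x => //; exact: cdistxx.
split; first by exists 0, x => //; exists x => //; exact: cdistxx.
by exists (1 / 2) => _ [y _ [z _ <-]]; exact: cdist_le_half.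
Qed.

Lemma cdiam_le (A : set (@circ R)) e : 0 <= e ->
  (forall x y, A x -> A y -> cdist x y <= e) -> cdiam A <= e.
Proof.
move=> e0 h; have [->|/set0P[x Ax]] := eqVneq A set0.
  rewrite /cdiam (_ : [set _ | _ in _ & _ in _] = set0) ?sup0//.
  by apply/seteqP; split => // _ [x []].
apply: ge_sup; first by exists (cdist x x), x => //; exists x.
by move=> _ [y Ay [z Az <-]]; exact: h.
Qed.

(* If h n pulls all grid points close to t, then the connected set g n (~` B(t, e)) misses the
   grid, so it has small diameter. *)
Lemma cdiam_cvg0 (g h : nat -> @circ R -> @circ R) t (A : set (@circ R)) :
  (forall n, ccontinuous (g n)) -> (forall n, cancel (g n) (h n)) ->
  (forall N i, ccvg (fun n => h n (grid N i)) t) ->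
  circ_closed A -> ~ A t -> (cdiam (g n @` A) @[n --> \oo] --> (0 : R)).
Proof.
move=> cg gK ht cA At.
have [e e0 Ae] : exists2 e, 0 < e & forall a, A a -> ~ cball t e a.
  apply: contrapT => hn; apply: At; apply: cA => e e0; apply: contrapT => ha.
  by apply: hn; exists e => // a Aa ta; apply: ha; exists a.
apply/cvgrPdist_lt => dlt d0.
have := near_infty_natSinv_lt (PosNum d0) => -[N _ /(_ N (leqnn N)) /= Nd].
have [K hK] := eventually_forall_lt N.+1
  (fun i => (circ_cvgP _ _).1 (ht N.+1 i) e e0).
exists K => // n Kn /=; rewrite sub0r normrN ger0_norm ?cdiam_ge0//.
apply: le_lt_trans Nd; apply: cdiam_le => [|_ _ [a Aa <-] [b Ab <-]]; first by rewrite invr_ge0.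
apply: (@cconn_grid R N.+1 (g n @` (~` cball t e))) => //.
- by apply: cconn_image => //; exact: cconn_cballC.
- by move=> i iN [u ut uE]; apply: ut; rewrite -(gK n u) uE; exact: hK.
- by exists a => //; exact: Ae.
- by exists b => //; exact: Ae.
Qed.

Lemma ccvg_unique (u : nat -> @circ R) l l' : ccvg u l -> ccvg u l' -> l = l'.
Proof.
move=> /circ_cvgP h /circ_cvgP h'; apply: contrapT => /cdist_gt0 ll'.
have [K hK] := h _ (divr2_gt0 ll'); have [K' hK'] := h' _ (divr2_gt0 ll').
have := hK _ (leq_maxl K K'); have := hK' _ (leq_maxr K K').
by have := cdist_triangle (u (maxn K K')) l l'; rewrite (cdistC l (u _)); lra.
Qed.

Lemma ccvg_image (f : @circ R -> @circ R) u l : ccontinuous f -> ccvg u l -> ccvg (f \o u) (f l).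
Proof.
move=> cf /circ_cvgP h; apply/circ_cvgP => e e0; have [d d0 hd] := cf l e e0.
have [K hK] := h d d0; exists K => n Kn /=.
by rewrite cdistC; apply: hd; rewrite cdistC; exact: hK.
Qed.

End Diameter.

Section Assembly.
Context {R : realType}.
Variables (nu : probability (@homB R) R) (P : probability (@seqB R) R).
Hypothesis prodP : is_product_measure nu P.

Lemma measurable_shift : measurable_fun setT (@sshift R).
Proof. by apply: measurable_seqP => i; exact: measurable_coord. Qed.

Lemma shift_invariant (S : set (@seqB R)) : measurable S -> P (@sshift R @^-1` S) = P S.
Proof.
move=> mS; have mS' : measurable (@sshift R @^-1` S) := measurable_preim measurable_shift mS.
rewrite (resample prodP 1 mS').
transitivity (\int[P]_v (\1_S v)%:E)%E; last by rewrite integral_indic// setIT.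
apply: eq_integral => v _; rewrite indicE.
have E u : sshift (mix 1 u v) = v by apply/funext => i; rewrite /sshift /mix /= subn1.
have [Sv|nSv] := pselect (S v).
  rewrite mem_set// (_ : [set u | _] = setT) ?probability_setT//.
  by apply/seteqP; split => // u _ /=; rewrite E.
rewrite memNset// (_ : [set u | _] = set0) ?measure0//.
by apply/seteqP; split => // u /=; rewrite E.
Qed.

Lemma ae_shift (Q : @seqB R -> Prop) : {ae P, forall w, Q w} -> {ae P, forall w, Q (sshift w)}.
Proof.
move=> [N [mN PN hN]]; exists (@sshift R @^-1` N); split.
- exact: (measurable_preim measurable_shift mN).
- by rewrite -PN; exact: shift_invariant.
- by move=> w /= hw; apply: hN.
Qed.

Lemma walk_shift (act : @homeo R -> @circ R -> @circ R) (w : @seqB R) n x :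
  walk act w n.+1 x = act (w 0%N) (walk act (sshift w) n x).
Proof.
rewrite -[LHS](_ : walk act (mix 1 w (sshift w)) (1 + n) x = _); first by rewrite walk_mix.
congr (walk act _ _ x); apply/funext => -[|i] //.
by rewrite /mix /sshift /= subn1.
Qed.

Lemma walk_lcomp (w : nat -> @homeo R) n : walk (@hfun R) w n = lcomp w n.
Proof. by elim: n => //= n ->. Qed.

Lemma walk_linv (w : nat -> @homeo R) n : walk (@hinv R) w n = linv w n.
Proof. by elim: n => //= n ->. Qed.

Lemma rinvK (w : nat -> @homeo R) n : cancel (rinv w n) (lcomp w n).
Proof. by elim: n => //= n IH x /=; rewrite hinvK. Qed.

Lemma rcompK (w : nat -> @homeo R) n : cancel (rcomp w n) (linv w n).
Proof. by elim: n => //= n IH x /=; rewrite hfunK. Qed.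

Lemma linvK (w : nat -> @homeo R) n : cancel (linv w n) (rcomp w n).
Proof. by elim: n => //= n IH x /=; rewrite IH hinvK. Qed.

Lemma rcomp_cont (w : nat -> @homeo R) n : ccontinuous (rcomp w n).
Proof.
elim: n => [|n IH]; first exact: id_ccont.
by apply: ccontinuous_comp => //; exact: hfun_cont.
Qed.

Lemma rinv_cont (w : nat -> @homeo R) n : ccontinuous (rinv w n).
Proof.
elim: n => [|n IH]; first exact: id_ccont.
by apply: ccontinuous_comp => //; exact: hinv_cont.
Qed.

(** Reading a finite word backwards turns outer composition into inner composition; this transfers
    the contraction of [walk] along [hfun] to the inverse of [linv]. *)
Lemma rcomp_rev (w : nat -> @homeo R) n :
  rcomp w n = walk (@hfun R) (fun i => w (n.-1 - i)%N) n.
Proof.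
elim: n => // n IH; apply/funext => x; rewrite walk_shift /= IH subn0.
congr (hfun _ (walk _ _ _ _)).
by apply/funext => i; rewrite /sshift; congr w; lia.
Qed.

Lemma balls_block_system (p q : 'I_36 -> @circ R) e :
  (forall j j' x, cball (p j) e x -> cball (p j') e x -> j = j') ->
  (forall j j' x, cball (q j) e x -> cball (q j') e x -> j = j') ->
  exists a b, block_system (fun j => cball (p j) e) (fun j => cball (q j) e) a b.
Proof.
move=> hp hq.
have fr j : exists ab : @circ R * @circ R, forall E x y, cconn E -> ~ E ab.1 -> ~ E ab.2 ->
    E x -> E y -> cball (p j) e x -> cball (p j) e y.
  by have [a [b h]] := cball_frontier (p j) e; exists (a, b).
have [ab hab] := choice fr.
exists (fun j => (ab j).1), (fun j => (ab j).2); split => //.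
by move=> j; exact: cconn_cball.
Qed.

Definition ball_cylinder (M : nat) (c : nat -> @homeo R) eta : set (@seqB R) :=
  [set w | forall i, (i < M)%N -> hball (c i) eta (w i)].

Lemma cylinder_blocks (M : nat) (c : 'I_36 -> nat -> @homeo R) eta :
  0 < eta -> (forall j i, hsupport nu (c j i)) ->
  (forall j, measurable (ball_cylinder M (c j) eta)) /\
  exists2 eps, 0 < eps <= 1 / 36 & forall j, (eps%:E <= P (ball_cylinder M (c j) eta))%E.
Proof.
move=> eta0 hc; pose B j := ball_cylinder M (c j) eta.
have mB j : measurable (B j).
  apply: rectangle_measurable; exists M, (fun i => hball (c j i) eta); split => // i.
  exact: hball_measurable.
split => //.
have PB0 j : (0 < P (B j))%E.
  have -> : P (B j) = (\prod_(i < M) nu (hball (c j i) eta))%E.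
    exact: (@prodP M (fun i => hball (c j i) eta) (fun i => hball_measurable _ _)).
  elim/big_ind: _ => [|x y x0 y0|i _]; [exact: lte01|exact: mule_gt0|exact: hc].
have fP j : (fine (P (B j)))%:E = P (B j) by rewrite fineK// fin_num_measure.
have f0 j : 0 < fine (P (B j)) by rewrite -lte_fin fP.
have [d d0 hd] := uniform_lower_bound f0.
exists (Num.min d (1 / 36)); first by rewrite lt_min d0 ge_min lexx orbT andbT; lra.
by move=> j; rewrite -fP lee_fin ge_min hd.
Qed.

Hypothesis prox : proximal (gen_semigroup (hsupport nu)).
Hypothesis nofix : fixes_no_point (gen_semigroup (hsupport nu)).

Lemma contracting_blocks_hfun : contracting_blocks (@hfun R) P.
Proof.
have [M [p [q [e [eta [ws [M0 e0 eta0 [hp hq hpq hX hw]]]]]]]] := contracting_words prox nofix 36.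
have [mB [eps epsb PB]] := cylinder_blocks M eta0 hX.
have [a [b bs]] := balls_block_system hp hq.
exists M, (fun j => cball (p j) e), (fun j => cball (q j) e), a, b,
  (fun j => ball_cylinder M (ws j) eta), eps; split => //; split.
- exact: mB.
(* A sequence in both cylinders sends [q j], which lies in no ball about the repelling points, into
   the balls about [q j] and [q j']; their disjointness forces j = j'. *)
- move=> j j' v Bj Bj'; apply: (hq j j' (walk (@hfun R) v M (q j))).
  + by apply: (hw j v Bj) => h; apply: (hpq j j (q j)) => //; rewrite /cball /= cdistxx.
  + by apply: (hw j' v Bj') => h; apply: (hpq j' j (q j)) => //; rewrite /cball /= cdistxx.
- exact: PB.
- by move=> j v z Bj; exact: hw.
Qed.

(* h maps the complement of I into J iff h^-1 maps the complement of J into I, so the blocks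
   of the inverse walk are the reversed words, with I and J exchanged. *)
Lemma contracting_blocks_hinv : contracting_blocks (@hinv R) P.
Proof.
have [M [p [q [e [eta [ws [M0 e0 eta0 [hp hq hpq hX hw]]]]]]]] := contracting_words prox nofix 36.
have [mB [eps epsb PB]] := cylinder_blocks M eta0 (fun j i => hX j (M.-1 - i)%N).
have [a [b bs]] := balls_block_system hq hp.
have hw' j v z : (forall i, (i < M)%N -> hball (ws j (M.-1 - i)%N) eta (v i)) ->
    ~ cball (q j) e z -> cball (p j) e (walk (@hinv R) v M z).
  move=> Bj qz; apply: contrapT => pz; apply: qz.
  rewrite -(linvK v M z) -walk_linv rcomp_rev; apply: (hw j) => // i iM.
  have iM' : (M.-1 - i < M)%N by lia.
  by have := Bj _ iM'; rewrite /hball /= (_ : (M.-1 - (M.-1 - i) = i)%N) //; lia.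
exists M, (fun j => cball (q j) e), (fun j => cball (p j) e), a, b,
  (fun j => ball_cylinder M (fun i => ws j (M.-1 - i)%N) eta), eps; split => //; split.
- exact: mB.
- move=> j j' v Bj Bj'; apply: (hp j j' (walk (@hinv R) v M (p j))).
  + by apply: (hw' j v _ Bj) => h; apply: (hpq j j (p j)) => //; rewrite /cball /= cdistxx.
  + by apply: (hw' j' v _ Bj') => h; apply: (hpq j j' (p j)) => //; rewrite /cball /= cdistxx.
- exact: PB.
- by move=> j v z Bj; exact: hw'.
Qed.

Lemma ae_grid (Q : @seqB R -> @circ R -> Prop) :
  (forall x, {ae P, forall w, Q w x}) -> {ae P, forall w, forall N i, Q w (grid N i)}.
Proof. by move=> h; exact: (ae_foralln (fun N => ae_foralln (fun i => h (grid N i)))). Qed.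

End Assembly.

Theorem theorem1p1 (R : realType)
  (nu : probability (@homB R) R) (P : probability (@seqB R) R) :
  is_product_measure nu P ->
  proximal (gen_semigroup (hsupport nu)) ->
  fixes_no_point (gen_semigroup (hsupport nu)) ->
  exists pi theta : @seqB R -> @circB R,
    measurable_fun (in_seq_support nu) pi /\
    measurable_fun (in_seq_support nu) theta /\
    (* (1) *)
    (forall x : circ,
      {ae P, forall w, in_seq_support nu w ->
        ccvg (fun n => lcomp w n x) (pi w) /\
        ccvg (fun n => linv w n x) (theta w)}) /\
    (* (2) *)
    {ae P, forall w, in_seq_support nu w ->
      forall A B : set circ, circ_closed A -> circ_closed B ->
        ~ A (theta w) -> ~ B (pi w) ->
        cdiam (rcomp w n @` A) @[n --> \oo] --> (0 : R) /\
        cdiam (rinv w n @` B) @[n --> \oo] --> (0 : R)} /\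
    (* (3) *)
    {ae P, forall w, in_seq_support nu w ->
      hfun (w 0%N) (pi (sshift w)) = pi w /\
      hfun (w 0%N) (theta w) = theta (sshift w)}.
Proof.
move=> prodP prox nofix.
have injf (f : @homeo R) : injective (hfun f) := can_inj (hfunK f).
have injv (f : @homeo R) : injective (hinv f) := can_inj (hinvK f).
have [pi [mpi hpi]] := walk_limit injf (@hfun_cont R) (@measurable_hfun R) prodP
  (contracting_blocks_hfun prodP prox nofix).
have [theta [mtheta htheta]] := walk_limit injv (@hinv_cont R) (@measurable_hinv R) prodP
  (contracting_blocks_hinv prodP prox nofix).
exists pi, theta; split; first exact: measurable_funTS.
split; first exact: measurable_funTS.
split; [|split].
- move=> x; have := hpi x; have := htheta x; apply: filterS2 => w h1 h2 _; split.
  + by under eq_fun do rewrite -walk_lcomp.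
  + by under eq_fun do rewrite -walk_linv.
(* The grid points tend to theta under [linv w n], the inverse of [rcomp w n], and to pi under
   [lcomp w n], the inverse of [rinv w n]. *)
- have := ae_grid hpi; have := ae_grid htheta; apply: filterS2 => w h1 h2 _ A B cA cB At Bp; split.
  + apply: (cdiam_cvg0 (rcomp_cont w) (rcompK w) _ cA At) => N i.
    by under eq_fun do rewrite -walk_linv; exact: h1.
  + apply: (cdiam_cvg0 (rinv_cont w) (rinvK w) _ cB Bp) => N i.
    by under eq_fun do rewrite -walk_lcomp; exact: h2.
- have hp := hpi circ0; have ht := htheta circ0.
  have hps := ae_shift prodP hp; have hts := ae_shift prodP ht.
  have hpp : {ae P, forall w : seqB, hfun (w 0%N) (pi (sshift w)) = pi w}.
    move: hp hps; apply: filterS2 => w /circ_cvgP h1 /(ccvg_image (hfun_cont (w 0%N))) h2.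
    apply: (ccvg_unique h2); apply/circ_cvgP => e /h1 [N hN]; exists N => n Nn /=.
    by rewrite -walk_shift; apply: hN; exact: leqW.
  (* Comparing limits gives f_1^-1 (theta (sigma w)) = theta w; applying f_1 then yields the stated
     form. *)
  have htt : {ae P, forall w : seqB, hinv (w 0%N) (theta (sshift w)) = theta w}.
    move: ht hts; apply: filterS2 => w /circ_cvgP h1 /(ccvg_image (hinv_cont (w 0%N))) h2.
    apply: (ccvg_unique h2); apply/circ_cvgP => e /h1 [N hN]; exists N => n Nn /=.
    by rewrite -walk_shift; apply: hN; exact: leqW.
  by move: hpp htt; apply: filterS2 => w h1 h2 _; split => //; rewrite -h2 hinvK.
Qed.
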